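(* Let $w\in S_n$ be a covexillary permutation with essential set $\mathcal{E}ss(w)=\{(p_1+1,q_1),\dots,(p_{m-1}+1,q_{m-1})\}$, where $p_1\le\cdots\le p_{m-1}$ and $q_1\le\cdots\le q_{m-1}$. Put $r_i=\mathbf r^w_{p_i+1,q_i}$ and $t_i=p_i+q_i$ for $1\le i\le m-1$, and $p_m=q_m=n$. Let $\tau\in S_{2n}$ be the permutation matrix defined in the context. Let $Gr_{\underline v}$ be the Schubert subvariety of $Gr(n,2n)$ given by $$Gr_{\underline v}=\{V\in Gr(n,2n) : \dim(V+E_{t_i})\le n+p_i+r_i\ \ \forall\,1\le i\le m-1\}.$$ Then the composite map $\tau\circ h:\mathfrak g\to Gr(n,2n)$, $x\mapsto\tau\,\mathrm{Col}\begin{pmatrix}I(n)\\ x\end{pmatrix}$, induces an open immersion $\mathfrak g_w\hookrightarrow Gr_{\underline v}$.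
   Context: Everything is over $\mathbb C$. $\mathfrak g$ is the space of $n\times n$ matrices, and $B\subset GL_n$ is the group of invertible upper triangular matrices. $w\in S_n$ is identified with the matrix with $1$s in positions $(w(i),i)$ and $0$s elsewhere. $\mathfrak g_w=\overline{BwB}\subset\mathfrak g$ is the matrix Schubert variety (reduced closure in $\mathfrak g$). Rank matrix: $\mathbf r^w_{ij}$ is the rank of the submatrix of $w$ with rows $i,\dots,n$ and columns $1,\dots,j$. Diagram: for each nonzero entry of $w$, shade its box, every box above it in its column, and every box to its right in its row; $D(w)$ is the set of unshaded boxes $(p,q)$ (row $p$, column $q$). Essential set: $\mathcal{E}ss(w)=\{(p,q)\in D(w): (p-1,q),(p,q+1),(p-1,q+1)\notin D(w)\}$. $w$ is covexillary if its essential set goes from top-left to bottom-right, i.e., its elements can be listed as $(p_1+1,q_1),\dots,(p_{m-1}+1,q_{m-1})$ with $p_1\le\cdots\le p_{m-1}$ and $q_1\le\cdots\le q_{m-1}$. $Gr(n,2n)$ is the Grassmannian of $n$-dimensional subspaces of $\mathbb C^{2n}$, $E_k=\langle e_1,\dots,e_k\rangle\subset\mathbb C^{2n}$, $\mathrm{Col}$ denotes column span, and $h(x)=\mathrm{Col}\begin{pmatrix}I(n)\\ x\end{pmatrix}$. The permutation matrix $\tau$ acts on $Gr(n,2n)$ by $V\mapsto\tau V$. With $p_0=q_0=0$, it is the $2n\times 2n$ permutation matrix that reorders the basis by interleaving blocks: for $1\le i\le m$, $\tau(e_k)=e_{k+p_{i-1}}$ for $q_{i-1}<k\le q_i$, and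 $\tau(e_{n+k})=e_{k+q_i}$ for $p_{i-1}<k\le p_i$. (So the row blocks of $\tau$, from top to bottom, have sizes $q_1,\,p_1,\,q_2-q_1,\,p_2-p_1,\dots,q_m-q_{m-1},\,p_m-p_{m-1}$; in particular $\tau^{-1}E_{t_i}=\langle e_1,\dots,e_{q_i},e_{n+1},\dots,e_{n+p_i}\rangle$.) Schubert varieties in $Gr(n,2n)$ are closures of orbits of the invertible upper triangular $2n\times2n$ matrices. ''Induces an open immersion'' means that the restriction to $\mathfrak g_w$ lands in $Gr_{\underline v}$ and is an isomorphism onto an open subvariety of it. *)

(* Defs.v *)
From HB Require Import structures.
From mathcomp Require Import all_boot all_order all_algebra all_fingroup.
From mathcomp Require Import classical_sets reals.
From mathcomp Require Import complex mpoly.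

Set Implicit Arguments.
Unset Strict Implicit.
Unset Printing Implicit Defensive.

Import GRing.Theory.
Local Open Scope ring_scope.

(* Reduced varieties over an algebraically closed field are treated
   classically, as sets of closed points with a Zariski topology and a sheaf of
   scalar-valued regular functions. Only the values of f on U matter in
   [regular U f]. *)
Record fun_space (K : closedFieldType) := FunSpace {
  point :> Type;
  zopen : set (set point);
  regular : set point -> set (point -> K)
}.

Section Subvarieties.
Local Open Scope classical_set_scope.
Variable K : closedFieldType.
Implicit Types S T : fun_space K.

Definition zclosure S (A : set S) : set S :=
  [set x | forall U, zopen U -> U x -> A `&` U !=set0].

(* A (locally closed) subset X of S carries the induced reduced structure:
   the subspace topology, and functions which are locally restrictions of
   regular functions of S. *)
Definition open_in S (X U : set S) : Prop :=
  exists2 W, zopen W & U = X `&` W.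

Definition regular_in S (U : set S) (f : S -> K) : Prop :=
  forall x, U x -> exists W, exists g : S -> K,
    [/\ zopen W, W x, regular W g & forall y, U y -> W y -> f y = g y].

Definition morphism_var S T (X : set S) (Y : set T) (phi : S -> T) : Prop :=
  [/\ forall x, X x -> Y (phi x),
      forall V, open_in Y V -> open_in X (X `&` phi @^-1` V) &
      forall V f, open_in Y V -> regular_in V f ->
        regular_in (X `&` phi @^-1` V) (f \o phi)].

Definition isomorphism_var S T (X : set S) (Y : set T) (phi : S -> T) : Prop :=
  morphism_var X Y phi /\
  exists psi : T -> S,
    [/\ morphism_var Y X psi,
        forall x, X x -> psi (phi x) = x &
        forall y, Y y -> phi (psi y) = y].

Definition open_immersion S T (X : set S) (Y : set T) (phi : S -> T) : Prop :=
  exists2 V, open_in Y V & isomorphism_var X V phi.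

End Subvarieties.

Section AffineSpace.
Local Open Scope classical_set_scope.
Variables (K : closedFieldType) (m n : nat).

Definition mxeval (P : {mpoly K[m * n]}) (x : 'M[K]_(m, n)) : K :=
  P.@[fun k => mxvec x 0 k].

Definition mx_space : fun_space K := {|
  point := 'M[K]_(m, n);
  zopen := [set U | exists I : set {mpoly K[m * n]},
    U = [set x | exists2 P, I P & mxeval P x != 0]];
  regular := fun U f => forall x, U x -> exists P Q : {mpoly K[m * n]},
    mxeval Q x != 0 /\
    forall y, U y -> mxeval Q y != 0 -> f y = mxeval P y / mxeval Q y
|}.

End AffineSpace.

Section Grassmannian.
Local Open Scope classical_set_scope.
Variables (K : closedFieldType) (d N : nat).

Definition Gr_point := {V : {vspace 'cV[K]_N} | \dim V == d}.

Definition increasing := {f : {ffun 'I_d -> 'I_N} |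
  [forall i : 'I_d, forall j : 'I_d, (i < j)%N ==> (f i < f j)%N]}.

Definition frame (V : Gr_point) : 'M[K]_(N, d) :=
  \matrix_(i, j) (vbasis (val V))`_j i 0.

(* Homogeneous coordinates of the image of V under the Pluecker embedding;
   the choice of basis in [frame] only rescales them. *)
Definition plucker (V : Gr_point) (k : 'I_#|{: increasing}|) : K :=
  \det (rowsub (val (enum_val k)) (frame V)).

Definition pleval (P : {mpoly K[#|{: increasing}|]}) (V : Gr_point) : K :=
  P.@[plucker V].

Definition Gr : fun_space K := {|
  point := Gr_point;
  zopen := [set U | exists I : set {mpoly K[#|{: increasing}|]},
    (forall P, I P -> exists e, P \is e.-homog) /\
    U = [set V | exists2 P, I P & pleval P V != 0]];
  regular := fun U f => forall V, U V ->
    exists e, exists P Q : {mpoly K[#|{: increasing}|]},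
    [/\ P \is e.-homog, Q \is e.-homog, pleval Q V != 0 &
      forall W, U W -> pleval Q W != 0 -> f W = pleval P W / pleval Q W]
|}.

Lemma dim_mul_unitmx (g : 'M[K]_N) (V : Gr_point) : g \in unitmx ->
  \dim (linfun (mulmx g : 'cV_N -> 'cV_N) @: val V)%VS == d.
Proof.
move=> gU; rewrite limg_dim_eq ?(valP V)//.
suff -> : lker (linfun (mulmx g : 'cV[K]_N -> 'cV_N)) = 0%VS by rewrite capv0.
apply/eqP/lker0P => u v; rewrite !lfunE /= => /(congr1 (mulmx (invmx g))).
by rewrite !mulKmx.
Qed.

Definition gl_act (g : 'M[K]_N) (gU : g \in unitmx) (V : Gr) : Gr :=
  exist _ (linfun (mulmx g : 'cV_N -> 'cV_N) @: val (V : Gr_point))%VS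
    (dim_mul_unitmx V gU).

End Grassmannian.

Section SchubertVarieties.
Local Open Scope classical_set_scope.
Variable K : closedFieldType.

(* [is_trig_mx] means lower triangular. *)
Definition borel n (b : 'M[K]_n) : bool := (b \in unitmx) && is_trig_mx b^T.

(* The 1s are in positions (s j, j), so that e_j is sent to e_(s j); this is
   [perm_mx s^-1]. *)
Definition permmx n (s : 'S_n) : 'M[K]_n := \matrix_(i, j) (i == s j)%:R.

Lemma permmx_unit n (s : 'S_n) : permmx s \in unitmx.
Proof.
suff -> : permmx s = perm_mx s^-1 by apply: unitmx_perm.
by apply/matrixP => i j; rewrite !mxE (canF_eq (permKV s)) eq_sym eq_sym.
Qed.

Definition matrix_schubert n (w : 'S_n) : set (mx_space K n n) :=
  zclosure [set x : mx_space K n n | exists b1 b2 : 'M[K]_n,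
    [/\ borel b1, borel b2 & x = b1 *m permmx w *m b2]].

Definition is_schubert_variety d N (X : set (Gr K d N)) : Prop :=
  exists V0 : Gr K d N, X = zclosure [set V : Gr K d N |
    exists b : 'M[K]_N, exists bU : b \in unitmx,
      borel b /\ V = gl_act bU V0].

Definition colspan N d (A : 'M[K]_(N, d)) : {vspace 'cV[K]_N} :=
  <<[seq col j A | j <- enum 'I_d]>>%VS.

Definition Estd N (k : nat) : {vspace 'cV[K]_N} :=
  <<[seq (delta_mx i 0 : 'cV[K]_N)%R | i : 'I_N <- enum 'I_N & (i < k)%N]>>%VS.

Lemma dim_graph n (x : 'M[K]_n) : \dim (colspan (col_mx 1%:M x)) == n.
Proof.
have fr : free [seq col j (col_mx (1%:M : 'M[K]_n) x) | j <- enum 'I_n].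
  set s := map _ _.
  have sz : size s = n by rewrite size_map size_enum_ord.
  apply/(@freeP _ _ _ (Tuple (introT eqP sz))) => c /= H i.
  have := congr1 (fun u : 'cV[K]_(n + n) => u (lshift n i) 0) H.
  rewrite summxE [RHS]mxE (bigD1 i) //= big1 ?addr0.
    rewrite mxE (nth_map i) ?size_enum_ord // nth_ord_enum.
    by rewrite mxE col_mxEu mxE eqxx mulr1.
  move=> j ji; rewrite mxE (nth_map i) ?size_enum_ord // nth_ord_enum.
  by rewrite mxE col_mxEu mxE eq_sym (negbTE ji) mulr0.
by move/eqP: fr; rewrite /colspan => ->; rewrite size_map size_enum_ord.
Qed.

Definition graph_map n (x : mx_space K n n) : Gr K n (n + n) :=
  exist _ (colspan (col_mx 1%:M (x : 'M[K]_n))) (dim_graph x).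

Definition tau_graph_map n (tau : 'S_(n + n)) (x : mx_space K n n) :
    Gr K n (n + n) :=
  gl_act (permmx_unit tau) (graph_map x).

(* Rank of the submatrix with (1-based) rows i, ..., n and columns 1, ..., j. *)
Definition rank_sw n (w : 'S_n) (i j : nat) : nat :=
  let rows := [set a : 'I_n | i <= a.+1]%N%SET in
  let cols := [set b : 'I_n | b.+1 <= j]%N%SET in
  \rank (mxsub (@enum_val _ (mem rows)) (@enum_val _ (mem cols)) (permmx w)).

Definition Gr_v n (m : nat) (p q r : nat -> nat) : set (Gr K n (n + n)) :=
  [set V | forall i, (1 <= i < m)%N ->
    (\dim (val (V : Gr_point K n (n + n)) + Estd (n + n) (p i + q i))%VS
      <= n + p i + r i)%N].

End SchubertVarieties.

Section Diagrams.
Variables (n : nat) (w : 'S_n).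

(* Boxes are pairs (row, column) of 0-based indices, and the nonzero entries of
   w are in the boxes (w j, j). *)
Definition shaded (c : 'I_n * 'I_n) : bool :=
  [exists j : 'I_n, (c.2 == j) && (c.1 <= w j)%N
                 || (c.1 == w j) && (j <= c.2)%N].

Definition diagram : {set 'I_n * 'I_n} := [set c | ~~ shaded c].

Definition essential : {set 'I_n * 'I_n} :=
  [set c in diagram | [forall d in diagram,
    ~~ [|| (d.1.+1 == c.1 :> nat) && (d.2 == c.2),
           (d.1 == c.1) && (d.2 == c.2.+1 :> nat) |
           (d.1.+1 == c.1 :> nat) && (d.2 == c.2.+1 :> nat)]]].

(* The essential set, in 1-based coordinates, is
   {(p 1 + 1, q 1), ..., (p (m-1) + 1, q (m-1))} with p and q weakly
   increasing. *)
Definition essential_listing (m : nat) (p q : nat -> nat) : Prop :=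
  [/\ [seq ((c.1 : nat).+1, (c.2 : nat).+1) | c : 'I_n * 'I_n <- enum essential]
        =i [seq ((p i).+1, q i) | i <- iota 1 m.-1],
      forall i j, (1 <= i <= j)%N -> (j < m)%N -> (p i <= p j)%N &
      forall i j, (1 <= i <= j)%N -> (j < m)%N -> (q i <= q j)%N].

Definition covexillary : Prop :=
  exists m : nat, exists p q : nat -> nat, essential_listing m p q.

End Diagrams.

(* Indices k : 'I_n are 0-based; [lshift n k] and [rshift n k] are the indices
   of e_(k+1) and e_(n+k+1). When p 0 = q 0 = 0, p m = q m = n and p, q are
   weakly increasing, this determines tau. *)
Definition interleaving n (m : nat) (p q : nat -> nat) (tau : 'S_(n + n)) :
    Prop :=
  forall i, (1 <= i <= m)%N ->
    (forall k : 'I_n, (q i.-1 <= k < q i)%N ->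
       tau (lshift n k) = (k + p i.-1)%N :> nat) /\
    (forall k : 'I_n, (p i.-1 <= k < p i)%N ->
       tau (rshift n k) = (k + q i)%N :> nat).

(* Main.v *)
Require Import Defs.
From HB Require Import structures.
From mathcomp Require Import all_boot all_order all_algebra all_fingroup.
From mathcomp Require Import classical_sets reals.
From mathcomp Require Import complex mpoly.
From mathcomp Require Import zify.

(* Both sides are governed by ranks. A point [V] of [Gr(n, 2n)] satisfies the
   conditions defining [Gr_v] iff it has a basis [v_0, ..., v_(n-1)] with [v_k]
   in [E_(jump k)] for an explicit increasing sequence [jump]. Such bases form a
   linear space, so [Gr_v] is the closure of a Borel orbit: deform [v_k] to
   [v_k + s e_(jump k)].

   On the chart [tau (h x)] the same conditions say that the southwest ranks of
   [x] at the essential boxes are at most those of [w], which bounds all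
   southwest ranks. Any such [x] lies in the closure of [B w B]: the segment
   joining adapted bases of [tau (h x)] and [tau (h w)] gives a rational curve
   from [x] to [w] within these conditions, and its generic point has exactly
   the southwest ranks of [w], hence lies in [B w B]. *)

(** The argument uses neither irreducibility nor a dimension count. Open sets are given by
    nonvanishing polynomials, so a point belongs to a closure as soon as it lies on a curve all but
    finitely many of whose points lie in the set. The obstacle is to find such a curve inside the
    rank conditions, which are not linear in [x]. They become linear only for bases adapted to a
    flag, and the flag comes from covexillarity: the spaces spanned by the first [q i] vectors of
    the top half and the first [p i] of the bottom half form a chain because [p] and [q] increase
    together, and [tau] carries this chain to standard subspaces. Along the curve the upper bounds
    on ranks hold wherever it is defined, and the lower bounds hold generically because they hold at
    [w].

    The condition on [V + E_(t i)] is used in the form dim (V ∩ E_(t i)) >= [q i - r i], since E_(t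
    i) has dimension [p i + q i]. *)

Section CovexillarySchubert.
Local Set Implicit Arguments.
Local Unset Strict Implicit.
Local Unset Printing Implicit Defensive.
Import GRing.Theory.
Local Open Scope ring_scope.

(** * Polynomial functions, generic parameters and minors *)

Section PolynomialFunctions.

(** Isolating the ring operations lets one treatment of determinants, adjugates and polynomial
    evaluation serve four classes: polynomials in one parameter, polynomials in matrix entries,
    functions on the Grassmannian chart, and rational functions of a parameter. *)
Record function_algebra (K : comNzRingType) (T : Type)
    (C : (T -> K) -> Prop) : Prop := FunctionAlgebra {
  fa_ext : forall f g, f =1 g -> C f -> C g;
  fa_cst : forall c, C (fun=> c);
  fa_add : forall f g, C f -> C g -> C (fun t => f t + g t);
  fa_mul : forall f g, C f -> C g -> C (fun t => f t * g t) }.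

Section Closure.
Variables (K : comNzRingType) (T : Type) (C : (T -> K) -> Prop).
Hypothesis CA : function_algebra C.

Lemma fa_sum I (s : seq I) (P : pred I) (F : I -> T -> K) :
  (forall i, C (F i)) -> C (fun t => \sum_(i <- s | P i) F i t).
Proof.
move=> CF; elim: s => [|i s IH].
  by apply: (fa_ext CA) (fa_cst CA 0) => t; rewrite big_nil.
case Pi: (P i); last by apply: (fa_ext CA) IH => t; rewrite big_cons Pi.
by apply: (fa_ext CA) (fa_add CA (CF i) IH) => t; rewrite big_cons Pi.
Qed.

Lemma fa_prod I (s : seq I) (P : pred I) (F : I -> T -> K) :
  (forall i, C (F i)) -> C (fun t => \prod_(i <- s | P i) F i t).
Proof.
move=> CF; elim: s => [|i s IH].
  by apply: (fa_ext CA) (fa_cst CA 1) => t; rewrite big_nil.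
case Pi: (P i); last by apply: (fa_ext CA) IH => t; rewrite big_cons Pi.
by apply: (fa_ext CA) (fa_mul CA (CF i) IH) => t; rewrite big_cons Pi.
Qed.

Lemma fa_exp f e : C f -> C (fun t => f t ^+ e).
Proof.
move=> Cf; elim: e => [|e IH]; first exact: (fa_ext CA) (fa_cst CA 1).
by apply: (fa_ext CA) (fa_mul CA Cf IH) => t; rewrite exprS.
Qed.

Lemma fa_det n (M : T -> 'M[K]_n) :
  (forall i j, C (fun t => M t i j)) -> C (fun t => \det (M t)).
Proof.
move=> CM; apply: fa_sum => s; apply: (fa_mul CA); first exact: (fa_cst CA).
exact: fa_prod.
Qed.

Lemma fa_mulmx a b c (M : T -> 'M[K]_(a, b)) (N : T -> 'M[K]_(b, c)) :
  (forall i j, C (fun t => M t i j)) -> (forall i j, C (fun t => N t i j)) ->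
  forall i j, C (fun t => (M t *m N t) i j).
Proof.
move=> CM CN i j.
have CMN k : C (fun t => M t i k * N t k j) by apply: (fa_mul CA).
by apply: (fa_ext CA) (fa_sum _ xpredT CMN) => t; rewrite mxE.
Qed.

Lemma fa_adj n (M : T -> 'M[K]_n) :
  (forall i j, C (fun t => M t i j)) -> forall i j, C (fun t =>
    (\adj (M t)) i j).
Proof.
move=> CM i j; have Ccof : C (fun t => cofactor (M t) j i).
  apply: (fa_mul CA); first exact: (fa_cst CA).
  apply: fa_det => k l.
  by apply: (fa_ext CA) (CM (lift j k) (lift i l)) => t; rewrite !mxE.
by apply: (fa_ext CA) Ccof => t; rewrite mxE.
Qed.

Lemma fa_meval n (P : {mpoly K[n]}) (v : T -> 'I_n -> K) :
  (forall i, C (fun t => v t i)) -> C (fun t => P.@[v t]).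
Proof.
move=> Cv.
have CP m : C (fun t => P@_m * \prod_i v t i ^+ m i).
  apply: (fa_mul CA); first exact: (fa_cst CA).
  by apply: fa_prod => i; apply: fa_exp.
by apply: (fa_ext CA) (fa_sum (msupp P) xpredT CP) => t; rewrite mevalE.
Qed.

End Closure.

Definition poly_fun (K : comNzRingType) (f : K -> K) :=
  exists P : {poly K}, forall s, f s = P.[s].

Lemma poly_fun_algebra (K : comNzRingType) : function_algebra (@poly_fun K).
Proof.
split=> [f g fg [P fP]|c|f g [P fP] [Q gQ]|f g [P fP] [Q gQ]].
- by exists P => s; rewrite -fg.
- by exists c%:P => s; rewrite hornerC.
- by exists (P + Q) => s; rewrite hornerD fP gQ.
- by exists (P * Q) => s; rewrite hornerM fP gQ.
Qed.

Lemma poly_fun_id (K : comNzRingType) : poly_fun (@id K).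
Proof. by exists 'X => s; rewrite hornerX. Qed.

Section Generic.
Variable K : closedFieldType.

(* [A] holds for all but finitely many [s]. *)
Definition generic (A : K -> Prop) :=
  exists2 P : {poly K}, P != 0 & forall s, P.[s] != 0 -> A s.

Lemma generic_and (A B : K -> Prop) :
  generic A -> generic B -> generic (fun s => A s /\ B s).
Proof.
move=> [P P0 PA] [Q Q0 QB]; exists (P * Q); first by rewrite mulf_neq0.
by move=> s; rewrite hornerM mulf_eq0 negb_or => /andP[/PA ? /QB ?].
Qed.

Lemma generic_imp (A B : K -> Prop) :
  (forall s, A s -> B s) -> generic A -> generic B.
Proof. by move=> AB [P P0 PA]; exists P => // s /PA /AB. Qed.

Lemma generic_all (I : eqType) (r : seq I) (A : I -> K -> Prop) :
  (forall i, i \in r -> generic (A i)) ->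
  generic (fun s => forall i, i \in r -> A i s).
Proof.
elim: r => [|i r IH] H; first by exists 1; rewrite ?oner_neq0.
have [//||P P0 PA] := @generic_and (A i) (fun s => forall i, i \in r -> A i s).
- by apply: H; rewrite mem_head.
- by apply: IH => j jr; apply: H; rewrite inE jr orbT.
by exists P => // s /PA[Ai Ar] j; rewrite inE => /predU1P[->|/Ar].
Qed.

Lemma generic_ex (A : K -> Prop) : generic A -> exists s, A s.
Proof.
by move=> [P P0 PA]; have /closed_nonrootP[s Ps] := P0; exists s; apply: PA.
Qed.

Lemma generic_neq0 (f : K -> K) s0 :
  poly_fun f -> f s0 != 0 -> generic (fun s => f s != 0).
Proof.
move=> [P fP] f0; exists P; last by move=> s; rewrite fP.
by apply: contraNneq f0 => P0; rewrite fP P0 horner0.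
Qed.

(** Any [k] rows of a maximal independent family stay independent, and [k] independent columns can
    be chosen in them. With the converse below, a lower bound on a rank becomes the nonvanishing of
    a polynomial, hence an open condition, and a generic one along curves. *)
Lemma mxrank_minor (m n : nat) (A : 'M[K]_(m, n)) k : (k <= \rank A)%N ->
  exists f : 'I_k -> 'I_m, exists g : 'I_k -> 'I_n,
    \det (mxsub f g A) != 0.
Proof.
move=> kA.
have rA : \rank (rowsub (maxrankfun A) A) = \rank A.
  by have /eqP := maxrowsub_free A; rewrite /row_free.
set A1 := rowsub (maxrankfun A \o widen_ord kA) A.
have rA1 : row_free A1.
  have /row_freeP[B AB] := maxrowsub_free A.
  apply/row_freeP; exists (B *m (rowsub (widen_ord kA) 1%:M)^T).
  rewrite mulmxA.
  have -> : A1 = rowsub (widen_ord kA) (rowsub (maxrankfun A) A).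
    by apply/matrixP => i j; rewrite !mxE.
  rewrite mul_rowsub_mx AB.
  apply/matrixP => i j; rewrite !mxE (bigD1 (widen_ord kA i)) //= !mxE eqxx
    mul1r.
  rewrite big1 ?addr0; first by rewrite -!val_eqE /= eq_sym.
  by move=> l; rewrite !mxE eq_sym => /negbTE ->; rewrite mul0r.
have rT : row_full A1^T by rewrite /row_full mxrank_tr; exact: rA1.
exists (maxrankfun A \o widen_ord kA), (fullrankfun rT).
have := fullrowsub_unit rT; rewrite unitmxE unitfE -det_tr.
by congr (\det _ != 0); apply/matrixP => i j; rewrite !mxE.
Qed.

Lemma minor_mxrank (m n : nat) (A : 'M[K]_(m, n)) k
    (f : 'I_k -> 'I_m) (g : 'I_k -> 'I_n) :
  \det (mxsub f g A) != 0 -> (k <= \rank A)%N.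
Proof.
rewrite -unitfE -unitmxE -row_free_unit => /eqP <-.
have -> : mxsub f g A = rowsub f 1%:M *m A *m colsub g 1%:M.
  by rewrite -rowsubE mulmx_colsub mulmx1; apply/matrixP => i j; rewrite !mxE.
by apply: leq_trans (mxrankM_maxl _ _) (mxrankM_maxr _ _).
Qed.

End Generic.
End PolynomialFunctions.

(** * Ranks of submatrices through diagonal idempotents *)

Section Masks.
Variable K : fieldType.

(** Rows and columns are zeroed instead of deleted, so all blocks of a matrix have one type and
    their ranks compare through products. *)
Definition mask n (S : pred 'I_n) : 'M[K]_n := diag_mx (\row_i (S i)%:R).
Definition ge_pred n i : pred 'I_n := fun k => (i <= k)%N.
Definition lt_pred n j : pred 'I_n := fun k => (k < j)%N.

Lemma mul_mask_mx m n (S : pred 'I_m) (A : 'M_(m, n)) i j :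
  (mask S *m A) i j = (S i)%:R * A i j.
Proof. by rewrite mul_diag_mx !mxE. Qed.

Lemma mul_mx_mask m n (S : pred 'I_n) (A : 'M_(m, n)) i j :
  (A *m mask S) i j = A i j * (S j)%:R.
Proof. by rewrite mul_mx_diag !mxE. Qed.

Lemma mask_entry n (S : pred 'I_n) i j : mask S i j = ((i == j) && S i)%:R.
Proof. by rewrite !mxE; case: eqP => [->|]; rewrite ?mulr1n ?mulr0n. Qed.

Lemma eq_mask n (S T : pred 'I_n) : S =1 T -> mask S = mask T.
Proof. by move=> ST; apply/matrixP => i j; rewrite !mask_entry ST. Qed.

Lemma mulmask n (S T : pred 'I_n) : mask S *m mask T = mask (predI S T).
Proof.
apply/matrixP => i j; rewrite mul_mask_mx !mask_entry /=.
by case: (S i); rewrite ?mul1r ?mul0r ?andbF.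
Qed.

Lemma mask_idem n (S : pred 'I_n) : mask S *m mask S = mask S.
Proof. by rewrite mulmask; apply: eq_mask => i /=; rewrite andbb. Qed.

Lemma mask_predC n (S : pred 'I_n) : 1%:M - mask S = mask (predC S).
Proof.
apply/matrixP => i j; rewrite !mxE.
by case: eqP => _; rewrite ?mulr1n ?mulr0n ?subr0 //=; case: (S i);
  rewrite ?subr0 ?subrr.
Qed.

Lemma rowsub_mask m (S : pred 'I_m) (T : {set 'I_m}) : S =1 mem T ->
  (rowsub (@enum_val _ (mem T)) 1%:M)^T *m rowsub (@enum_val _ (mem T)) 1%:M
  = mask S.
Proof.
move=> ST; apply/matrixP => i j; rewrite mxE mask_entry ST /=.
under eq_bigr do rewrite !mxE -natrM mulnb.
have [iT|iT] := boolP (i \in T); last first.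
  rewrite andbF big1 // => k _; case: eqP => //= ki.
  by move: (enum_valP k); rewrite ki (negbTE iT).
rewrite andbT (bigD1 (enum_rank_in iT i)) //= enum_rankK_in // eqxx big1 ?addr0
  //.
move=> k /negP kn; case: eqP => //= ki; case: kn.
by apply/eqP; apply: enum_val_inj; rewrite enum_rankK_in.
Qed.

(** Each matrix is a product containing the other: selecting rows factors through the mask, and the
    mask is the selection followed by its transpose. *)
Lemma rank_mxsub_mask m n (S : pred 'I_m) (T : pred 'I_n) (S' : {set 'I_m})
    (T' : {set 'I_n}) (A : 'M_(m, n)) : S =1 mem S' -> T =1 mem T' ->
  \rank (mxsub (@enum_val _ (mem S')) (@enum_val _ (mem T')) A)
    = \rank (mask S *m A *m mask T).
Proof.
move=> SS TT.
set U := rowsub (@enum_val _ (mem S')) (1%:M : 'M[K]_m).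
set V := rowsub (@enum_val _ (mem T')) (1%:M : 'M[K]_n).
have -> : mxsub (@enum_val _ (mem S')) (@enum_val _ (mem T')) A = U *m A *m V^T.
  rewrite -rowsubE; apply/matrixP => i j; rewrite !mxE.
  rewrite (bigD1 (enum_val j)) //= big1 ?addr0;
    first by rewrite !mxE eqxx mulr1.
  by move=> k kj; rewrite !mxE eq_sym (negbTE kj) mulr0.
have US : U *m mask S = U.
  apply/matrixP => i j; rewrite mul_mx_mask !mxE SS.
  case: eqP => [<-|]; rewrite ?mul0r //.
  by have /= -> := enum_valP i; rewrite mulr1.
have TV : mask T *m V^T = V^T.
  apply/matrixP => i j; rewrite mul_mask_mx !mxE TT.
  case: eqP => [<-|]; rewrite ?mulr0 //.
  by have /= -> := enum_valP j; rewrite mul1r.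
apply/eqP; rewrite eqn_leq; apply/andP; split.
  have -> : U *m A *m V^T = U *m (mask S *m A *m mask T) *m V^T.
    by rewrite !mulmxA US -!mulmxA TV.
  exact: leq_trans (mxrankM_maxl _ _) (mxrankM_maxr _ _).
rewrite -(rowsub_mask SS) -(rowsub_mask TT) -/U -/V -!mulmxA.
apply: leq_trans (mxrankM_maxr _ _) _; rewrite !mulmxA; exact: mxrankM_maxl.
Qed.

Lemma rank_mask n (S : pred 'I_n) : \rank (mask S) = #|S|.
Proof.
have SS : S =1 mem [set i | S i] by move=> i /=; rewrite inE.
have := rank_mxsub_mask 1%:M SS SS; rewrite mulmx1 mask_idem => <-.
have -> : mxsub (@enum_val _ (mem [set i | S i]))
    (@enum_val _ (mem [set i | S i])) (1%:M : 'M[K]_n) = 1%:M.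
  by apply/matrixP => i j; rewrite !mxE (inj_eq enum_val_inj).
by rewrite mxrank1; apply: eq_card => i; rewrite inE.
Qed.

(** Subtracting [Y *m P] from [Y] keeps the row space of the stack. The remainder is killed by [P],
    while [P] fixes its own row space, so the two row spaces meet in 0. *)
Lemma rank_col_mx_idem m n (P : 'M[K]_n) (Y : 'M_(m, n)) : P *m P = P ->
  \rank (col_mx P Y) = (\rank P + \rank (Y *m (1%:M - P)))%N.
Proof.
move=> PP; rewrite -addsmxE -mxrank_disjoint_sum.
  apply/eqP; rewrite eqn_leq; apply/andP; split; apply: mxrankS.
    rewrite addsmx_sub addsmxSl /=.
    have {1}-> : Y = Y *m P + Y *m (1%:M - P).
      by rewrite -mulmxDr addrC subrK mulmx1.
    by rewrite addmx_sub_adds ?submxMl.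
  rewrite addsmx_sub addsmxSl /=.
  have -> : Y *m (1%:M - P) = - Y *m P + Y.
    by rewrite mulmxBr mulmx1 mulNmx addrC.
  by rewrite addmx_sub_adds ?submxMl.
apply/eqP/rowV0P => v; rewrite sub_capmx => /andP[/submxP[a va] /submxP[b vb]].
have vP : v *m P = v by rewrite va -mulmxA PP.
by rewrite -vP vb -!mulmxA mulmxBl mul1mx PP subrr !mulmx0.
Qed.

Lemma rank_row_mx_idem m n (P : 'M[K]_n) (Y : 'M_(n, m)) : P *m P = P ->
  \rank (row_mx Y P) = (\rank P + \rank ((1%:M - P) *m Y))%N.
Proof.
move=> PP; rewrite -mxrank_tr tr_row_mx -addsmxE addsmxC addsmxE.
rewrite rank_col_mx_idem -?trmx_mul ?PP // mxrank_tr; congr (_ + _)%N.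
by rewrite -mxrank_tr trmx_mul trmxK linearB /= trmxK trmx1.
Qed.

(** The first [j] columns span a subspace of the span of the first [j.+1], so no growth of the rank
    forces equality of the spans; conversely a dependent column is recovered by multiplication on
    the right. *)
Lemma col_sub_prev m n (Y : 'M[K]_(m, n)) (j : 'I_n) :
  (\rank (Y *m mask (@lt_pred n j.+1)) <= \rank (Y *m mask (@lt_pred n j)))%N
    <->
  exists c : 'cV_n, Y *m delta_mx j 0 = Y *m mask (@lt_pred n j) *m c.
Proof.
have lt_lt : mask (@lt_pred n j.+1) *m mask (@lt_pred n j) =
  mask (@lt_pred n j).
  rewrite mulmask; apply: eq_mask => k /=; rewrite /lt_pred ltnS.
  by case: ltngtP.
split=> [rk|[c Yc]].
  have : ((Y *m mask (@lt_pred n j.+1))^T <= (Y *m mask (@lt_pred n j))^T)%MS.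
    have [] := @mxrank_leqif_sup _ _ _ _ ((Y *m mask (@lt_pred n j))^T) ((Y *m
      mask (@lt_pred n j.+1))^T).
      by rewrite -lt_lt mulmxA [X in (X <= _)%MS]trmx_mul submxMl.
    by move=> le <-; rewrite eqn_leq le !mxrank_tr.
  move=> /submxP[D /(congr1 trmx)]; rewrite trmxK trmx_mul trmxK => E.
  exists (D^T *m delta_mx j 0); rewrite mulmxA -E -mulmxA; congr (_ *m _).
  apply/matrixP => i k; rewrite mul_mask_mx !mxE /lt_pred.
  by case: eqP => [->|]; rewrite ?ltnSn ?mul1r ?mulr0.
have -> : Y *m mask (@lt_pred n j.+1)
    = Y *m mask (@lt_pred n j) *m (1%:M + c *m delta_mx 0 j).
  rewrite mulmxDr mulmx1 mulmxA -Yc -!mulmxA -mulmxDr; congr (_ *m _).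
  rewrite mul_delta_mx; apply/matrixP => i k;
    rewrite [RHS]mxE !mask_entry mxE /lt_pred ltnS.
  have [<-|ik] := eqVneq i k; rewrite /= ?andbb ?add0r.
    by rewrite leq_eqVlt val_eqE; case: (i =P j) => [->|];
      rewrite ?ltnn ?add0r ?addr0.
  by have [<-|] := eqVneq i j; rewrite //= eq_sym (negbTE ik).
exact: mxrankM_maxl.
Qed.

End Masks.

(** * Southwest ranks and Bruhat cells *)

Section BruhatCells.
Variables (K : closedFieldType) (n : nat).
Implicit Types (x b : 'M[K]_n) (w : 'S_n) (i j : nat).

(* The southwest block of [x] is represented by the full matrix in which the
   other entries are replaced by 0. *)
Definition sw_rank x i j : nat :=
  \rank (mask K (@ge_pred n i) *m x *m mask K (@lt_pred n j)).

Lemma upperP b : reflect (forall i j : 'I_n, (j < i)%N -> b i j = 0)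
  (is_trig_mx b^T).
Proof.
apply: (iffP is_trig_mxP) => bT i j ij; last by rewrite mxE bT.
by rewrite -(bT j i ij) mxE.
Qed.

Lemma upper_diag_neq0 b : is_trig_mx b^T ->
  (b \in unitmx) = [forall i, b i i != 0].
Proof.
move=> bT; rewrite unitmxE unitfE -det_tr det_trig // prodf_seq_neq0.
apply/allP/forallP => H i; first by have := H i (mem_index_enum _); rewrite mxE.
by rewrite mxE H.
Qed.

Lemma borel_invmx b : borel b -> borel (invmx b).
Proof.
move=> /andP[bU bT]; rewrite /borel unitmx_inv bU /=; apply/upperP => i j.
(* Rows are treated from the bottom up: below the diagonal, entry [(i, j)] of [b *m invmx b] is then
   the pivot [b i i] times the unknown entry. *)
have [k] := ubnP (n - i); elim: k i => // k IH i ik ji.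
have := congr1 (fun A : 'M_n => A i j) (mulmxV bU).
rewrite !mxE -val_eqE /= gtn_eqF //= (bigD1 i) //= big1 ?addr0.
  move/eqP; rewrite mulf_eq0 => /predU1P[b0|/eqP//].
  by move: bU; rewrite (upper_diag_neq0 bT) => /forallP/(_ i); rewrite b0 eqxx.
move=> l; rewrite -val_eqE neq_ltn /= => /orP[li|il].
  by rewrite (upperP _ bT) ?mul0r.
by rewrite IH ?mulr0 //; have := ltn_ord l; lia.
Qed.

Lemma ge_mask_upper b i : is_trig_mx b^T ->
  mask K (@ge_pred n i) *m b *m mask K (@ge_pred n i) =
    mask K (@ge_pred n i) *m b.
Proof.
move=> /upperP bT; apply/matrixP => k l;
  rewrite mul_mx_mask mul_mask_mx /ge_pred.
case: (leqP i k) => ik; rewrite ?mul0r // mul1r.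
by case: (leqP i l) => il; rewrite ?mulr1 // bT ?mulr0 //; lia.
Qed.

Lemma upper_lt_mask b j : is_trig_mx b^T ->
  mask K (@lt_pred n j) *m b *m mask K (@lt_pred n j) =
    b *m mask K (@lt_pred n j).
Proof.
move=> /upperP bT; apply/matrixP => k l;
  rewrite mul_mx_mask mul_mask_mx mul_mx_mask.
rewrite /lt_pred; case: (ltnP l j) => lj; rewrite ?mulr0 // !mulr1.
by case: (ltnP k j) => kj; rewrite ?mul1r // bT ?mulr0 //; lia.
Qed.

(** On the left an upper triangular matrix adds lower rows to higher ones, on the right it adds
    earlier columns to later ones; a southwest block of the product thus depends only on the same
    block of [x]. *)
Lemma sw_rank_upper b1 b2 x i j : is_trig_mx b1^T -> is_trig_mx b2^T ->
  (sw_rank (b1 *m x *m b2) i j <= sw_rank x i j)%N.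
Proof.
move=> b1T b2T; rewrite /sw_rank.
have -> : mask K (@ge_pred n i) *m (b1 *m x *m b2) *m mask K (@lt_pred n j)
  = (mask K (@ge_pred n i) *m b1) *m
    (mask K (@ge_pred n i) *m x *m mask K (@lt_pred n j)) *m
    (b2 *m mask K (@lt_pred n j)).
  transitivity (mask K (@ge_pred n i) *m b1 *m x *m (b2 *m mask K (@lt_pred n
    j))).
    by rewrite !mulmxA.
  rewrite -[in LHS](upper_lt_mask j b2T) ![in RHS]mulmxA ge_mask_upper // ![in
    LHS]mulmxA.
  by [].
exact: leq_trans (mxrankM_maxl _ _) (mxrankM_maxr _ _).
Qed.

Lemma sw_rank_perm w i j :
  sw_rank (permmx K w) i j = #|[pred k : 'I_n | (k < j)%N && (i <= w k)%N]|.
Proof.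
rewrite /sw_rank.
have -> : mask K (@ge_pred n i) *m permmx K w
    = permmx K w *m mask K (fun k => i <= w k)%N.
  apply/matrixP => k l; rewrite mul_mx_mask mul_mask_mx !mxE /ge_pred.
  by case: eqP => [->|]; rewrite ?mulr1 ?mul1r ?mulr0 ?mul0r.
rewrite -mulmxA mulmask eqmxMfull ?row_full_unit ?permmx_unit // rank_mask.
by apply: eq_card => k; exact: (andbC (i <= w k)%N (k < j)%N).
Qed.

Lemma sw_rank_prev w (j : 'I_n) i :
  sw_rank (permmx K w) i j.+1 = (sw_rank (permmx K w) i j + (i <= w j))%N.
Proof.
rewrite !sw_rank_perm; case: leqP => wj.
  rewrite addn1 (cardD1 j) !inE ltnSn wj add1n; congr _.+1.
  apply: eq_card => k; rewrite !inE ltnS leq_eqVlt val_eqE.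
  by case: eqP => [->|]; rewrite ?ltnn.
rewrite addn0; apply: eq_card => k; rewrite !inE ltnS leq_eqVlt val_eqE.
by case: eqP => [->|] //=; rewrite leqNgt wj andbF.
Qed.

(* As the ranks jump exactly at the ones of [w], column [j] of [x] can be cleared
   below row [w j] by the previous columns,
     and its entry in row [w j] survives. *)
Lemma mem_bruhat_cell x w :
  (forall i j, (i <= n)%N -> (j <= n)%N ->
    sw_rank x i j = sw_rank (permmx K w) i j) ->
  exists b1 b2 : 'M[K]_n, [/\ borel b1, borel b2 & x = b1 *m permmx K w *m b2].
Proof.
move=> xw.
have colx (j : 'I_n) : exists c : 'cV[K]_n,
    mask K (@ge_pred n (w j).+1) *m x *m (delta_mx j 0 - mask K (@lt_pred n j)
      *m c) = 0.
  have rk : (sw_rank x (w j).+1 j.+1 <= sw_rank x (w j).+1 j)%N.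
    by rewrite !xw ?ltn_ord ?(ltnW (ltn_ord _)) // sw_rank_prev ltnn addn0.
  have [c cE] := (col_sub_prev (mask K (@ge_pred n (w j).+1) *m x) j).1 rk.
  by exists c; rewrite mulmxBr cE mulmxA subrr.
have [c cP] := fin_all_exists colx.
pose b : 'M[K]_n := \matrix_(i, j) ((i == j)%:R - (i < j)%N%:R * c j i 0).
have colb (j : 'I_n) : col j b = delta_mx j 0 - mask K (@lt_pred n j) *m c j.
  apply/matrixP => i k; rewrite ord1 !mxE eqxx andbT; congr (_ - _).
  rewrite (bigD1 i) //= big1 ?addr0; first by rewrite !mxE eqxx mulr1n.
  by move=> l li; rewrite !mxE eq_sym (negbTE li) mulr0n mul0r.
have bT : is_trig_mx b^T.
  by apply/upperP => i j ji;
    rewrite mxE -val_eqE gtn_eqF // ltnNge ltnW //= mul0r subr0.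
have bB : borel b.
  rewrite /borel upper_diag_neq0 bT // andbT; apply/forallP => i.
  by rewrite mxE eqxx ltnn mul0r subr0 oner_neq0.
have colM (j : 'I_n) : x *m col j b = col j (x *m b) by rewrite !colE mulmxA.
have xb0 (i0 j0 : 'I_n) : (w j0 < i0)%N -> (x *m b) i0 j0 = 0.
  move=> ji; have := congr1 (fun A : 'cV_n => A i0 0) (cP j0).
  by rewrite -colb -mulmxA mul_mask_mx /ge_pred ji mul1r colM mxE [RHS]mxE.
have xbd (j : 'I_n) : (x *m b) (w j) j != 0.
  (* Were the pivot zero, column [j] would depend on its predecessors from row [w j] on, although
     the rank of [w] jumps there. *)
  apply/eqP => xb; have := sw_rank_prev w j (w j).
  rewrite -!xw ?ltn_ord ?(ltnW (ltn_ord _)) // leqnn addn1 => rk.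
  suff : (sw_rank x (w j) j.+1 <= sw_rank x (w j) j)%N by rewrite rk ltnn.
  apply/col_sub_prev; exists (c j); apply/eqP;
    rewrite -subr_eq0 -!mulmxA -!mulmxBr.
  rewrite -colb colM; apply/eqP/matrixP => i k.
  rewrite ord1 mul_mask_mx mxE [RHS]mxE /ge_pred.
  case: ltngtP => [/xb0->||ji]; rewrite ?mul0r ?mulr0 //.
  by rewrite (_ : i = w j) ?xb ?mulr0 //; apply: val_inj.
(* Column [k] is the column of [x *m b] whose pivot lies in row [k], so vanishing below the pivots
   becomes triangularity. *)
pose b1 : 'M[K]_n := \matrix_(i, k) (x *m b) i ((w^-1)%g k).
have b1w : b1 *m permmx K w = x *m b.
  apply/matrixP => i j; rewrite mxE (bigD1 (w j)) //= big1 ?addr0.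
    by rewrite [b1 _ _]mxE permK [permmx _ _ _ _]mxE eqxx mulr1.
  by move=> k kj; rewrite [permmx _ _ _ _]mxE (negbTE kj) mulr0.
have b1T : is_trig_mx b1^T.
  by apply/upperP => i k ki; rewrite mxE xb0 // permKV.
have b1B : borel b1.
  rewrite /borel upper_diag_neq0 b1T // andbT; apply/forallP => i.
  by rewrite mxE; have := xbd ((w^-1)%g i); rewrite permKV.
exists b1, (invmx b); split=> //; first exact: borel_invmx.
by rewrite b1w mulmxK //; case/andP: bB.
Qed.

Lemma sw_rank_bruhat_cell b1 b2 w i j : borel b1 -> borel b2 ->
  (sw_rank (b1 *m permmx K w *m b2) i j <= sw_rank (permmx K w) i j)%N.
Proof. by move=> /andP[_ ?] /andP[_ ?]; apply: sw_rank_upper. Qed.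

Lemma rank_sw_sw_rank w i j : rank_sw K w i.+1 j = sw_rank (permmx K w) i j.
Proof.
by apply: rank_mxsub_mask => k /=; rewrite inE.
Qed.

End BruhatCells.

(** * Reduction of all southwest rank bounds to the essential boxes *)

Section EssentialSet.
Variables (K : closedFieldType) (n : nat).
Implicit Types (x : 'M[K]_n) (w : 'S_n) (i j : nat).

Lemma sw_rank_mono x i i' j j' : (i' <= i)%N -> (j <= j')%N ->
  (sw_rank x i j <= sw_rank x i' j')%N.
Proof.
move=> ii jj; rewrite /sw_rank.
have -> : mask K (@ge_pred n i) =
  mask K (@ge_pred n i) *m mask K (@ge_pred n i').
  rewrite mulmask; apply: eq_mask => k /=; rewrite /ge_pred.
  by case: leqP => //= /(leq_trans ii) ->.
have -> : mask K (@lt_pred n j) =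
  mask K (@lt_pred n j') *m mask K (@lt_pred n j).
  rewrite mulmask; apply: eq_mask => k /=; rewrite /lt_pred.
  by case: ltnP => [/leq_trans ->//|]; rewrite ?andbF.
rewrite !mulmxA; apply: leq_trans (mxrankM_maxl _ _) _.
by rewrite -!mulmxA; apply: mxrankM_maxr.
Qed.

Lemma sw_rank_next_col x i j : (sw_rank x i j.+1 <= sw_rank x i j + 1)%N.
Proof.
have [jn|nj] := ltnP j n; last first.
  rewrite /sw_rank (_ : mask K (@lt_pred n j.+1) =
    mask K (@lt_pred n j)) ?leq_addr //.
  by apply: eq_mask => k; rewrite /lt_pred !(leq_trans (ltn_ord k)) // ltnW.
rewrite /sw_rank (_ : mask K (@lt_pred n j.+1)
  = mask K (@lt_pred n j) + mask K (pred1 (Ordinal jn))).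
  rewrite mulmxDr; apply: leq_trans (mxrank_add _ _) _; rewrite leq_add2l.
  apply: leq_trans (mxrankM_maxr _ _) _.
  by rewrite rank_mask card1.
apply/matrixP => k l; rewrite [RHS]mxE !mask_entry /lt_pred ltnS /= -!val_eqE
  /=.
by case: ltngtP => _; case: ltngtP => _ //=; rewrite ?addr0 ?add0r.
Qed.

Lemma sw_rank_prev_row x i j : (sw_rank x i j <= sw_rank x i.+1 j + 1)%N.
Proof.
have [jn|nj] := ltnP i n; last first.
  rewrite /sw_rank (_ : mask K (@ge_pred n i) =
    mask K (@ge_pred n i.+1)) ?leq_addr //.
  by apply: eq_mask => k; have kn := ltn_ord k; rewrite /ge_pred; lia.
rewrite /sw_rank (_ : mask K (@ge_pred n i)
  = mask K (@ge_pred n i.+1) + mask K (pred1 (Ordinal jn))).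
  rewrite !mulmxDl; apply: leq_trans (mxrank_add _ _) _; rewrite leq_add2l.
  apply: leq_trans (mxrankM_maxl _ _) _; apply: leq_trans (mxrankM_maxl _ _) _.
  by rewrite rank_mask card1.
apply/matrixP => k l; rewrite [RHS]mxE !mask_entry /ge_pred /= -!val_eqE /=.
by case: (ltngtP i k) => _; case: (ltngtP k l) => _ //=; rewrite ?addr0 ?add0r.
Qed.

Lemma sw_rank_perm_row w (a : 'I_n) j :
  sw_rank (permmx K w) a j
    = (sw_rank (permmx K w) a.+1 j + ((w^-1)%g a < j)%N)%N.
Proof.
rewrite !sw_rank_perm; case: ltnP => wj.
  rewrite addn1 (cardD1 ((w^-1)%g a)) !inE wj permKV leqnn add1n; congr _.+1.
  apply: eq_card => k; rewrite !inE (leq_eqVlt a) val_eqE -(inj_eq (@perm_inj _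
    w)) permKV (eq_sym a).
  by case: eqP => [->|] //=; rewrite ltnn andbF.
rewrite addn0; apply: eq_card => k; rewrite !inE (leq_eqVlt a) val_eqE.
case: eqP => [ak|] //=; rewrite ak ltnn andbF andbT.
by move: wj; rewrite ak permK leqNgt => /negbTE.
Qed.

Lemma in_diagram w (c : 'I_n * 'I_n) :
  (c \in diagram w) = (w c.2 < c.1)%N && (c.2 < (w^-1)%g c.1)%N.
Proof.
rewrite inE negb_exists; apply/forallP/andP => [H|[H1 H2] j].
  split; first by have := H c.2; rewrite eqxx negb_or -ltnNge => /andP[].
  by have := H ((w^-1)%g c.1); rewrite permKV eqxx negb_or -ltnNge => /andP[].
rewrite negb_or !negb_and -!ltnNge; apply/andP; split.
  by case: eqP => [<-|].
by case: eqP => [c1|] //=; rewrite c1 permK in H2.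
Qed.

(** Two descents. A diagram box that is not essential has a diagram neighbour above, to the right or
    diagonally, where [w] has the same rank and the block of [x] is larger. Outside the diagram the
    block can be shrunk instead, until it is empty or its corner is a diagram box. *)
Lemma sw_rank_essential w x :
  (forall c, c \in essential w ->
    (sw_rank x c.1 c.2.+1 <= sw_rank (permmx K w) c.1 c.2.+1)%N) ->
  forall i j, (sw_rank x i j <= sw_rank (permmx K w) i j)%N.
Proof.
move=> ess.
(* Moving up or right inside the diagram does not change the rank of [w]. *)
have diag c : c \in diagram w ->
    (sw_rank x c.1 c.2.+1 <= sw_rank (permmx K w) c.1 c.2.+1)%N.
  have [k] := ubnP (c.1 + (n - c.2)); elim: k c => // k IH c ck cD.
  have [/ess//|] := boolP (c \in essential w).
  rewrite inE cD /= => /forall_inPn[d dD]; rewrite negbK => cd.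
  have := dD; rewrite in_diagram => /andP[d1 d2].
  have rw1 : sw_rank (permmx K w) d.1 d.2.+1 =
    sw_rank (permmx K w) d.1.+1 d.2.+1.
    by rewrite sw_rank_perm_row ltnS leqNgt d2 addn0.
  have rw2 i : (d.1 <= i)%N -> sw_rank (permmx K w) i d.2.+1 =
    sw_rank (permmx K w) i d.2.
    by move=> di; rewrite sw_rank_prev leqNgt (leq_trans d1 di) addn0.
  have dk : (d.1 + (n - d.2) < k)%N.
    have := ltn_ord d.2; have := ltn_ord c.2; move: ck.
    have le_dc : (d.1 <= c.1)%N && (c.2 <= d.2)%N && ((d.1 < c.1) || (c.2 <
      d.2))%N.
      by case/or3P: cd => /andP[/eqP e1 /eqP e2];
        rewrite -?e1 ?e2 ?leqnn ?leqnSn ?ltnSn ?orbT.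
    move: (nat_of_ord d.1) (nat_of_ord d.2) (nat_of_ord c.1) (nat_of_ord c.2)
      le_dc.
    by move=> *; lia.
  have := IH d dk dD; case/or3P: cd => /andP[/eqP e1 /eqP e2].
  - rewrite rw1 e1 e2; apply: leq_trans; apply: sw_rank_mono => //.
    by rewrite -e1.
  - rewrite rw2 // e1 -e2; apply: leq_trans; exact: sw_rank_mono.
  - rewrite rw1 rw2 // e1 -e2; apply: leq_trans; apply: sw_rank_mono => //.
    by rewrite -e1.
move=> i j; have [k] := ubnP (n - i + j); elim: k i j => // k IH i j ijk.
have [ni|lti] := leqP n i.
  rewrite /sw_rank (_ : mask K (@ge_pred n i) = 0) ?mul0mx ?mxrank0 //.
  apply/matrixP => a b; rewrite mask_entry mxE /ge_pred leqNgt.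
  by rewrite (leq_trans (ltn_ord a) ni) andbF.
case: j ijk => [|j] ijk.
  rewrite /sw_rank (_ : mask K (@lt_pred n 0) = 0) ?mulmx0 ?mxrank0 //.
  by apply/matrixP => a b; rewrite mask_entry mxE andbF.
have IHj : (sw_rank x i j <= sw_rank (permmx K w) i j)%N by apply: IH; lia.
have [nj|ltj] := leqP n j.
  apply: leq_trans (sw_rank_mono _ (leqnn i) (leqnSn j)); apply: leq_trans IHj.
  rewrite /sw_rank (_ : mask K (@lt_pred n j.+1) = mask K (@lt_pred n j)) //.
  by apply: eq_mask => a; have := ltn_ord a; rewrite /lt_pred; lia.
pose a := Ordinal lti; pose b := Ordinal ltj.
(* Off the diagram, the last column or the top row of the block contains a 1 of [w] inside the
   block: removing it lowers the rank of [w] by exactly one and that of [x] by at most one. *)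
have [cD|] := boolP ((a, b) \in diagram w); first exact: diag cD.
rewrite in_diagram negb_and -!leqNgt => /orP[iw|wj].
  have -> := sw_rank_prev K w b i; rewrite iw.
  by apply: leq_trans (sw_rank_next_col _ _ _) _; rewrite leq_add2r.
have -> := sw_rank_perm_row w a j.+1; rewrite ltnS wj.
by apply: leq_trans (sw_rank_prev_row _ _ _) _; rewrite leq_add2r; apply: IH;
  rewrite /=; lia.
Qed.

Lemma sw_rank_essential_listing w m p q x : essential_listing w m p q ->
  (forall i, (1 <= i < m)%N ->
    (sw_rank x (p i) (q i) <= sw_rank (permmx K w) (p i) (q i))%N) ->
  forall i j, (sw_rank x i j <= sw_rank (permmx K w) i j)%N.
Proof.
move=> [ess _ _] H; apply: sw_rank_essential => c cE.
(* The 1-based box [((p i).+1, q i)] is the corner of the block with 0-based rows from [p i] on and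
   the first [q i] columns. *)
have : ((c.1 : nat).+1, (c.2 : nat).+1) \in [seq ((p i).+1,
  q i) | i <- iota 1 m.-1].
  by rewrite -ess; apply/mapP; exists c; rewrite ?mem_enum.
case/mapP => i; rewrite mem_iota => im [-> ->]; apply: H.
by case: m im {ess} => [|m] /=; lia.
Qed.

Lemma essential_listing_bound w m p q i : essential_listing w m p q ->
  (1 <= i < m)%N -> (p i < n)%N && (q i <= n)%N.
Proof.
move=> [ess _ _] im.
have : ((p i).+1, q i) \in [seq ((p i).+1, q i) | i <- iota 1 m.-1].
  by apply/map_f; rewrite mem_iota; case: m im {ess} => [|m] /=; lia.
by rewrite -ess => /mapP[c _ [-> ->]]; rewrite !ltn_ord.
Qed.

End EssentialSet.

(** * Column spaces, standard subspaces and changes of basis *)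

Section ColumnSpaces.
Variable K : closedFieldType.

Lemma mulmx_sum_col N d (A : 'M[K]_(N, d)) (c : 'cV_d) :
  A *m c = \sum_j c j 0 *: col j A.
Proof.
apply/matrixP => i k; rewrite ord1 mxE summxE; apply: eq_bigr => j _.
by rewrite !mxE mulrC.
Qed.

Lemma memv_colspan N d (A : 'M[K]_(N, d)) (v : 'cV_N) :
  reflect (exists c : 'cV_d, v = A *m c) (v \in colspan A).
Proof.
have sz : size [seq col j A | j <- enum 'I_d] =
  d by rewrite size_map size_enum_ord.
have nthA (j : 'I_d) : [seq col j A | j <- enum 'I_d]`_j = col j A.
  by rewrite (nth_map j) ?size_enum_ord // nth_ord_enum.
apply: (iffP idP) => [vA|[c ->]]; last first.
  rewrite mulmx_sum_col; apply: memv_suml => j _; apply: memvZ;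
    apply: memv_span.
  by apply: map_f; rewrite mem_enum.
exists (\col_j coord (Tuple (introT eqP sz)) j v).
rewrite mulmx_sum_col (coord_span (X := Tuple (introT eqP sz)) vA).
by apply: eq_bigr => j _; rewrite mxE -(coord_span (X := Tuple (introT eqP sz))
  vA) nthA.
Qed.

Lemma colspanS N d e (A : 'M[K]_(N, d)) (B : 'M[K]_(N, e)) :
  (forall j, exists c : 'cV_e, col j A = B *m c) -> (colspan A <= colspan B)%VS.
Proof.
move=> H; apply/subvP => v /memv_colspan[c ->]; rewrite mulmx_sum_col.
by apply: memv_suml => j _; apply: memvZ; apply/memv_colspan.
Qed.

Lemma colspan_mul N d e (A : 'M[K]_(N, d)) (C : 'M[K]_(d, e)) :
  (colspan (A *m C) <= colspan A)%VS.
Proof. by apply: colspanS => j; exists (col j C); rewrite !colE mulmxA. Qed.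

Lemma colspan_mul_unit N d (A : 'M[K]_(N, d)) (C : 'M[K]_d) : C \in unitmx ->
  colspan (A *m C) = colspan A.
Proof.
move=> CU; apply/eqP; rewrite eqEsubv colspan_mul /=.
by rewrite -[X in (colspan X <= _)%VS](mulmxK CU) colspan_mul.
Qed.

Lemma dim_colspan_full N d (A : 'M[K]_(N, d)) : row_full A ->
  \dim (colspan A) = d.
Proof.
move=> /row_fullP[B BA].
have sz : size [seq col j A | j <- enum 'I_d] =
  d by rewrite size_map size_enum_ord.
rewrite -[RHS]sz; apply/eqP;
  apply/(@freeP _ _ _ (Tuple (introT eqP sz))) => c /= H i.
have c0 : A *m \col_j c j = 0.
  rewrite mulmx_sum_col -[RHS]H; apply: eq_bigr => j _.
  by rewrite mxE (nth_map j) ?size_enum_ord // nth_ord_enum.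
have : \col_j c j = 0 by rewrite -[LHS]mul1mx -BA -mulmxA c0 mulmx0.
by move=> /(congr1 (fun u : 'cV_d => u i 0)); rewrite !mxE.
Qed.

Lemma dim_colspan N d (A : 'M[K]_(N, d)) : \dim (colspan A) = \rank A.
Proof.
rewrite -(dim_colspan_full (col_base_full A)); congr (\dim _).
apply/eqP; rewrite eqEsubv -{1}(mulmx_base A) colspan_mul /=.
have [B AB] := row_freeP (row_base_free A).
have := congr1 (mulmx^~ B) (mulmx_base A); rewrite -mulmxA AB mulmx1 => ->.
exact: colspan_mul.
Qed.

Lemma colspan_row_mx N d e (A : 'M[K]_(N, d)) (B : 'M[K]_(N, e)) :
  colspan (row_mx A B) = (colspan A + colspan B)%VS.
Proof.
apply/vspaceP => v; apply/memv_colspan/memv_addP =>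
  [[c ->]|[u /memv_colspan[a ->]]].
  rewrite -(vsubmxK c) mul_row_col; exists (A *m usubmx c);
    first by apply/memv_colspan; eexists.
  by exists (B *m dsubmx c) => //; apply/memv_colspan; eexists.
move=> [_ /memv_colspan[b ->] ->]; exists (col_mx a b); by rewrite mul_row_col.
Qed.

Lemma Estd_colspan N t : Estd K N t = colspan (mask K (@lt_pred N t)).
Proof.
apply/eqP; rewrite eqEsubv; apply/andP; split.
  apply/span_subvP => _ /mapP[k + ->]; rewrite mem_filter => /andP[kt _].
  apply/memv_colspan; exists (delta_mx k 0); apply/matrixP => l j.
  rewrite mul_mask_mx !mxE /lt_pred.
  by case: eqP => [->|]; rewrite ?kt ?mul1r ?mulr0.
apply/subvP => v /memv_colspan[c ->]; rewrite mulmx_sum_col.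
apply: memv_suml => j _; apply: memvZ.
have [jt|tj] := ltnP j t; last first.
  suff -> : col j (mask K (@lt_pred N t)) = 0 by apply: mem0v.
  apply/matrixP => k l; rewrite mxE mask_entry mxE /lt_pred.
  by case: eqP => //= ->; rewrite ltnNge tj.
suff -> : col j (mask K (@lt_pred N t)) = delta_mx j 0.
  by apply: memv_span; apply: map_f; rewrite mem_filter jt mem_enum.
apply/matrixP => k l; rewrite mxE mask_entry mxE ord1 eqxx andbT /lt_pred.
by case: eqP => //= ->; rewrite jt.
Qed.

Lemma card_lt_pred N t : (t <= N)%N -> #|@lt_pred N t| = t.
Proof.
move=> tN; rewrite -[RHS](card_ord t); have inj : injective (widen_ord tN).
  by move=> i j /(congr1 val) /= /val_inj.
rewrite -(card_imset _ inj); apply: eq_card => i.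
apply/idP/imsetP => [it|[k _ ->]]; last exact: (ltn_ord k).
by exists (Ordinal (it : i < t)%N) => //; apply: val_inj.
Qed.

(** Modulo the span of the first [t] basis vectors, only the rows of [A] from [t] on survive. *)
Lemma dim_add_Estd N d (A : 'M[K]_(N, d)) t : (t <= N)%N ->
  \dim (colspan A + Estd K N t) = (t + \rank (mask K (@ge_pred N t) *m A))%N.
Proof.
move=> tN; rewrite Estd_colspan -colspan_row_mx dim_colspan.
rewrite rank_row_mx_idem ?mask_idem // mask_predC rank_mask card_lt_pred //.
by rewrite (eq_mask _ (T := @ge_pred N t)) // => i; rewrite /= /lt_pred -leqNgt.
Qed.

Lemma dim_Estd N t : (t <= N)%N -> \dim (Estd K N t) = t.
Proof.
move=> tN; have := dim_add_Estd (0 : 'M_(N, 0)) tN.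
rewrite mulmx0 mxrank0 addn0 => {2}<-; congr (\dim _).
by apply/esym/addv_idPr/subvP => v /memv_colspan[c ->]; rewrite mul0mx mem0v.
Qed.

Section Points.
Variables d N : nat.
Implicit Types V : Gr_point K d N.

Lemma colspan_frame V : colspan (frame V) = val V.
Proof.
rewrite -[RHS](span_basis (vbasisP (val V))); congr (<<_>>)%VS.
have sz : size (vbasis (val V)) = d by rewrite size_tuple (eqP (valP V)).
apply: (@eq_from_nth _ 0) => [|i]; first by rewrite size_map size_enum_ord sz.
rewrite size_map size_enum_ord => id.
rewrite (nth_map (Ordinal id)) ?size_enum_ord // (nth_ord_enum _ (Ordinal id)).
by apply/matrixP => k l; rewrite !mxE ord1.
Qed.

Lemma rank_frame V : \rank (frame V) = d.
Proof. by rewrite -dim_colspan colspan_frame (eqP (valP V)). Qed.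

Lemma frame_eq V (A : 'M[K]_(N, d)) : val V = colspan A ->
  exists2 C, C \in unitmx & frame V = A *m C.
Proof.
move=> VA; have colC (j : 'I_d) : exists c : 'cV_d, col j (frame V) = A *m c.
  apply/memv_colspan; rewrite -VA -colspan_frame; apply/memv_colspan.
  by exists (delta_mx j 0); rewrite colE.
have [c cP] := fin_all_exists colC.
have E : frame V = A *m \matrix_(i, j) c j i 0.
  apply/matrixP => i j; have := congr1 (fun u : 'cV_N => u i 0) (cP j).
  by rewrite !mxE => ->; apply: eq_bigr => k _; rewrite mxE.
exists (\matrix_(i, j) c j i 0) => //;
  rewrite -row_free_unit /row_free eqn_leq rank_leq_row /=.
by rewrite -{1}(rank_frame V) E mxrankM_maxr.
Qed.

Lemma Gr_point_of (A : 'M[K]_(N, d)) : \rank A = d -> exists V,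
  val V = colspan A.
Proof.
by move=> rA; have dA : \dim (colspan A) == d;
  [rewrite dim_colspan rA | exists (exist (fun V : {vspace 'cV[K]_N} =>
  \dim V == d) _ dA)].
Qed.

Lemma gl_act_colspan g (gU : g \in unitmx) V (A : 'M[K]_(N, d)) :
  val V = colspan A -> val (gl_act gU V : Gr_point K d N) = colspan (g *m A).
Proof.
move=> /= ->; rewrite limg_span -map_comp; congr (<<_>>)%VS;
  apply: eq_map => j /=.
by rewrite lfunE /= !colE mulmxA.
Qed.

Definition pluckers (A : 'M[K]_(N, d)) (k : 'I_#|{: increasing d N}|) : K :=
  \det (rowsub (val (enum_val k)) A).

Lemma meval_dhomog r (P : {mpoly K[r]}) e c (v : 'I_r -> K) : P \is e.-homog ->
  P.@[fun i => c * v i] = c ^+ e * P.@[v].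
Proof.
move=> /dhomogP Pe; rewrite !mevalE mulr_sumr; apply: eq_big_seq => m mP.
rewrite mulrCA; congr (_ * _);
  rewrite -(Pe _ mP) /= mdegE -prodrXr -big_split /=.
by apply: eq_bigr => i _; rewrite exprMn.
Qed.

(** A change of basis multiplies every maximal minor by its determinant. The scalar does not depend
    on [P], so quotients of forms of equal degree may be computed on any spanning matrix instead of
    the opaque [frame V]. *)
Lemma pleval_colspan V (A : 'M[K]_(N, d)) : val V = colspan A ->
  exists2 c : K, c != 0 & forall e (P : {mpoly K[#|{: increasing d N}|]}),
    P \is e.-homog -> pleval P V = c ^+ e * P.@[pluckers A].
Proof.
move=> /frame_eq[C CU E]; exists (\det C); first by rewrite -unitfE -unitmxE.
move=> e P Pe; rewrite -meval_dhomog //; apply: meval_eq => k.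
rewrite /plucker E /pluckers mulrC -det_mulmx; congr (\det _).
by rewrite mul_rowsub_mx.
Qed.

End Points.
End ColumnSpaces.

(** * Maximal minors with arbitrary row choices *)

Section PluckerMinors.

Lemma enum_val_mono N (S : {set 'I_N}) (k l : 'I_#|S|) :
  (k < l)%N -> (enum_val k < enum_val l)%N.
Proof.
move=> kl; have x0 : 'I_N := enum_val k.
have srt : sorted (fun a b : 'I_N => (a < b)%N) (enum S).
  rewrite {1}/enum_mem; apply: sorted_filter; first by move=> a b c;
    apply: ltn_trans.
  by rewrite -enumT -(@sorted_map _ _ val ltn) val_enum_ord iota_ltn_sorted.
rewrite !(enum_val_nth x0).
have trans : transitive (fun a b : 'I_N => (a < b)%N) by move=> a b c;
  apply: ltn_trans.
by apply: (sorted_ltn_nth trans x0 srt); rewrite // inE -cardE.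
Qed.

Variables (K : closedFieldType) (d N : nat).

(** Coordinates are indexed by increasing row sequences only. A repeated row gives 0, and otherwise
    sorting the rows changes the minor by a sign. *)
Lemma minor_plucker (g : 'I_d -> 'I_N) :
  exists2 P : {mpoly K[#|{: increasing d N}|]}, P \is 1.-homog &
    forall A : 'M[K]_(N, d), P.@[pluckers A] = \det (rowsub g A).
Proof.
have [/injectiveP gI|/injectivePn[a [b ab gab]]] := boolP (injectiveb g);
  last first.
  exists 0; first exact: dhomog0.
  move=> A; rewrite meval0; apply/esym/(determinant_alternate ab) => j.
  by rewrite !mxE gab.
have cS : #|g @: [set: 'I_d]| = d by rewrite card_imset // cardsT card_ord.
pose h (k : 'I_d) := enum_val (cast_ord (esym cS) k).
have hinc : [forall i : 'I_d, forall j : 'I_d, (i < j)%N ==>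
    ([ffun k => h k] i < [ffun k => h k] j)%N].
  by apply/forallP => i; apply/forallP => j; apply/implyP => ij;
    rewrite !ffunE enum_val_mono.
have gS i : g i \in g @: [set: 'I_d] by apply: imset_f; rewrite inE.
pose s0 (i : 'I_d) := cast_ord cS (enum_rank_in (gS i) (g i)).
have hs0 i : h (s0 i) = g i by rewrite /h /s0 cast_ordK enum_rankK_in.
have s0I : injective s0 by move=> i j ij; apply: gI; rewrite -!hs0 ij.
pose ih : increasing d N := exist _ [ffun k => h k] hinc.
exists ((-1) ^+ perm s0I *: 'X_(enum_rank ih)).
  by rewrite dhomogZ // dhomogX /= mdeg1.
move=> A; rewrite mevalZ mevalXU /pluckers enum_rankK.
have -> : rowsub g A = row_perm (perm s0I) (rowsub (val ih) A).
  by apply/matrixP => i j; rewrite !mxE /= ffunE permE hs0.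
by rewrite row_permE det_mulmx det_perm.
Qed.

End PluckerMinors.

(** * The affine chart of graphs in the Grassmannian *)

Section GraphChart.
Local Open Scope classical_set_scope.
Variable K : closedFieldType.

Definition mx_fun m n (f : 'M[K]_(m, n) -> K) :=
  exists P : {mpoly K[m * n]}, forall x, f x = mxeval P x.

Lemma mx_fun_algebra m n : function_algebra (@mx_fun m n).
Proof.
split=> [f g fg [P fP]|c|f g [P fP] [Q gQ]|f g [P fP] [Q gQ]].
- by exists P => x; rewrite -fg.
- by exists (c%:MP) => x; rewrite /mxeval mevalC.
- by exists (P + Q) => x; rewrite /mxeval mevalD fP gQ.
- by exists (P * Q) => x; rewrite /mxeval mevalM fP gQ.
Qed.

Lemma mx_fun_entry m n i j : mx_fun (fun x : 'M[K]_(m, n) => x i j).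
Proof. by exists 'X_(mxvec_index i j) => x; rewrite /mxeval mevalXU mxvecE. Qed.

Lemma mx_open_neq0 m n (f : 'M[K]_(m, n) -> K) : mx_fun f ->
  zopen [set x : mx_space K m n | f x != 0].
Proof.
move=> [P fP]; exists [set P]; apply/seteqP; split=> x /=.
  by rewrite fP; exists P.
by move=> [_ ->]; rewrite fP.
Qed.

Section Chart.
Variables (n : nat) (tau : 'S_(n + n)).
Notation GrK := (Gr K n (n + n)).
Notation MxK := (mx_space K n n).
Notation phi := (tau_graph_map tau : MxK -> GrK).
Implicit Types (V : GrK) (A : 'M[K]_(n + n, n)).

Definition chart_top A : 'M[K]_n := rowsub (tau \o lshift n) A.
Definition chart_bot A : 'M[K]_n := rowsub (tau \o @rshift n n) A.

Lemma chart_split A : A = permmx K tau *m col_mx (chart_top A) (chart_bot A).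
Proof.
apply/matrixP => i j; have [k ->] : exists k, i = tau k.
  by exists ((tau^-1)%g i); rewrite permKV.
rewrite mxE (bigD1 k) //= [permmx _ _ _ _]mxE eqxx mul1r big1 ?addr0.
  by case: (split_ordP k) => l ->; rewrite ?col_mxEu ?col_mxEd mxE.
by move=> l lk; rewrite mxE (inj_eq perm_inj) eq_sym (negbTE lk) mul0r.
Qed.

Definition graph_mx (x : 'M[K]_n) : 'M[K]_(n + n, n) :=
  permmx K tau *m col_mx 1%:M x.

Lemma chart_graph_mx (x : 'M[K]_n) :
  chart_top (graph_mx x) = 1%:M /\ chart_bot (graph_mx x) = x.
Proof.
have E := chart_split (graph_mx x); rewrite {1}/graph_mx in E.
have /(congr1 (mulmx (invmx (permmx K tau)))) := E.
by rewrite !mulKmx ?permmx_unit // => /eq_col_mx[<- <-].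
Qed.

Lemma chart_mul A (C : 'M[K]_n) :
  (chart_top (A *m C) = chart_top A *m C) * (chart_bot (A *m C) =
    chart_bot A *m C).
Proof. by rewrite /chart_top /chart_bot !mul_rowsub_mx. Qed.

Lemma val_phi (x : 'M[K]_n) :
  val (tau_graph_map tau x : Gr_point K n (n + n)) = colspan (graph_mx x).
Proof. exact: gl_act_colspan. Qed.

Definition chart_domain : set GrK := [set V | \det (chart_top (frame V)) != 0].

Definition chart_inv (V : GrK) : MxK :=
  chart_bot (frame V) *m invmx (chart_top (frame V)).

Lemma chart_domain_colspan V A :
  val (V : Gr_point K n (n + n)) = colspan A ->
  chart_domain V <-> chart_top A \in unitmx.
Proof.
move=> /frame_eq[C CU E]; rewrite /chart_domain /= E chart_mul.
by rewrite -unitfE -unitmxE unitmx_mul CU andbT.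
Qed.

Lemma chart_inv_colspan V A :
  val (V : Gr_point K n (n + n)) = colspan A -> chart_top A \in unitmx ->
  chart_inv V = chart_bot A *m invmx (chart_top A).
Proof.
move=> /frame_eq[C CU E] AU; rewrite /chart_inv E !chart_mul.
have -> : invmx (chart_top A *m C) = invmx C *m invmx (chart_top A).
  apply: (can_inj (mulKmx (_ : chart_top A *m C \in unitmx))).
    by rewrite unitmx_mul AU.
  by rewrite mulmxV ?unitmx_mul ?AU // mulmxA mulmxK // mulmxV.
by rewrite mulmxA mulmxK.
Qed.

Lemma chart_domain_phi (x : MxK) : chart_domain (phi x).
Proof.
by apply/(chart_domain_colspan (val_phi x));
  rewrite (chart_graph_mx _).1 unitmx1.
Qed.

Lemma chart_inv_phi (x : MxK) : chart_inv (phi x) = x.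
Proof.
rewrite (chart_inv_colspan (val_phi x)) (chart_graph_mx _).1 ?unitmx1 //.
by rewrite (chart_graph_mx _).2 invmx1 mulmx1.
Qed.

Lemma phi_chart_inv V : chart_domain V -> phi (chart_inv V) = V.
Proof.
move=> /(chart_domain_colspan (esym (colspan_frame V))) VU.
apply: val_inj; apply: etrans (val_phi _) _; rewrite -[RHS]colspan_frame.
rewrite -[RHS](colspan_mul_unit _ (C := invmx (chart_top (frame V))))
  ?unitmx_inv //.
congr colspan; rewrite /graph_mx /chart_inv; set T := chart_top _.
have -> : frame V *m invmx T
    = permmx K tau *m (col_mx T (chart_bot (frame V)) *m invmx T).
  by rewrite mulmxA -chart_split.
by rewrite mul_col_mx mulmxV.
Qed.

Lemma phi_pullback (P : {mpoly K[#|{: increasing n (n + n)}|]}) :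
  exists Q, forall x, mxeval Q x = P.@[pluckers (graph_mx x)].
Proof.
suff [Q QP] : mx_fun (fun x => P.@[pluckers (graph_mx x)]) by exists Q.
apply: fa_meval => [|k]; first exact: mx_fun_algebra.
apply: fa_det => [|i j]; first exact: mx_fun_algebra.
apply: (fa_ext (mx_fun_algebra n n)) (fa_mulmx (mx_fun_algebra n n)
  (M := fun=> permmx K tau) (N := fun x => col_mx 1%:M x)
  _ _ (val (enum_val k) i) j) => [x|a b|a b]; first by rewrite [RHS]mxE.
  exact: (fa_cst (mx_fun_algebra n n)).
case: (split_ordP a) => l ->.
  by apply: (fa_ext (mx_fun_algebra n n)) (fa_cst (mx_fun_algebra n n) (1%:M l
    b)) => x; rewrite col_mxEu.
by apply: (fa_ext (mx_fun_algebra n n)) (mx_fun_entry l b) => x;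
  rewrite col_mxEd.
Qed.

Lemma phi_open (U : set GrK) : zopen U -> zopen (phi @^-1` U).
Proof.
move=> [I [Ihom ->]].
exists [set Q | exists2 P, I P & forall x,
  mxeval Q x = P.@[pluckers (graph_mx x)]].
apply/seteqP; split=> x /=.
  move=> [P IP]; have [e Pe] := Ihom P IP;
    have [c c0 cE] := pleval_colspan (val_phi x).
  rewrite (cE e) // mulf_eq0 negb_or => /andP[_ Px].
  by have [Q QP] := phi_pullback P; exists Q; [exists P | rewrite QP].
move=> [Q [P IP QP] Qx]; exists P => //; have [e Pe] := Ihom P IP.
have [c c0 cE] := pleval_colspan (val_phi x).
by rewrite (cE e) // mulf_neq0 ?expf_neq0 -?QP.
Qed.

Lemma phi_regular (U : set GrK) (f : GrK -> K) : regular U f ->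
  regular (phi @^-1` U) (f \o phi).
Proof.
move=> Uf x /Uf[e [P [Q [Pe Qe Qx fPQ]]]].
have [P' P'E] := phi_pullback P; have [Q' Q'E] := phi_pullback Q.
exists P', Q'; split.
  have [c c0 cE] := pleval_colspan (val_phi x).
  by apply: contraNneq Qx => Q'0; rewrite (cE e) // -Q'E Q'0 mulr0.
move=> y Uy Q'y; have [c c0 cE] := pleval_colspan (val_phi y).
have Qy : pleval Q (phi y) != 0 by rewrite (cE e) // mulf_neq0 ?expf_neq0 -?Q'E.
by rewrite /= fPQ // !(cE e) // -P'E -Q'E -mulf_div divff ?expf_neq0 ?mul1r.
Qed.

(* Functions on the chart that become homogeneous in Pluecker coordinates after
   multiplication by a power of the coordinate defining the chart. *)
Definition chart_fun (f : GrK -> K) := exists e,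
  exists2 P : {mpoly K[#|{: increasing n (n + n)}|]}, P \is e.-homog &
  forall V, chart_domain V -> pleval P V =
    \det (chart_top (frame V)) ^+ e * f V.

Lemma chart_det_plucker : exists2 P : {mpoly K[#|{: increasing n (n + n)}|]},
  P \is 1.-homog & forall V, pleval P V = \det (chart_top (frame V)).
Proof.
have [P P1 PE] := minor_plucker K (tau \o lshift n).
by exists P => // V; apply: PE.
Qed.

Lemma chart_fun_algebra : function_algebra chart_fun.
Proof.
have [D D1 DE] := chart_det_plucker.
have De e : D ^+ e \is e.-homog by have := dhomogMn e D1; rewrite mul1n.
have DeE e V : pleval (D ^+ e) V = \det (chart_top (frame V)) ^+ e.
  by rewrite /pleval rmorphXn /= -DE.
split=> [f g fg [e [P Pe fP]]|c|f g [e [P Pe fP]] [e' [Q Qe gQ]]|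
    f g [e [P Pe fP]] [e' [Q Qe gQ]]].
- by exists e, P => // V VD; rewrite fP // fg.
- exists 0%N, (c *: 1); first exact/dhomogZ/dhomog1.
  by move=> V _; rewrite /pleval mevalZ meval1 mulr1 mul1r.
- exists (e + e')%N, (P * D ^+ e' + D ^+ e * Q).
    by rewrite rpredD ?dhomogM.
  move=> V VD; rewrite /pleval mevalD !mevalM -!/(pleval _ V) fP // gQ // !DeE.
  by rewrite exprD mulrDr mulrAC mulrA.
- exists (e + e')%N, (P * Q); first by rewrite dhomogM.
  move=> V VD; rewrite /pleval mevalM -!/(pleval _ V) fP // gQ //.
  by rewrite exprD mulrACA.
Qed.

Lemma chart_inv_entry i j : chart_fun (fun V => (chart_inv V : 'M[K]_n) i j).
Proof.
(* Cramer's rule: row [i] of the bottom replaces row [j] of the top. *)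
pose g (k : 'I_n) := tau (if k == j then rshift n i else lshift n k).
have [P P1 PE] := minor_plucker K g; exists 1%N, P => // V VD.
rewrite [LHS](PE (frame V)) expr1 /chart_inv; set T := chart_top _;
  set Y := chart_bot _.
have TU : T \in unitmx by rewrite unitmxE unitfE.
rewrite /invmx TU -scalemxAr mxE mulrA mulrV -?unitmxE // mul1r.
rewrite (expand_det_row _ j) mxE; apply: eq_bigr => k _.
rewrite !mxE /g eqxx; congr (_ * (_ * \det _)).
apply/matrixP => a b; rewrite !mxE /= /g.
by rewrite eq_sym (negbTE (neq_lift j a)).
Qed.

Lemma chart_pullback (P : {mpoly K[n * n]}) :
  chart_fun (fun V => mxeval P (chart_inv V)).
Proof.
apply: fa_meval => [|k]; first exact: chart_fun_algebra.
by case/mxvec_indexP: k => i j;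
  apply: (fa_ext chart_fun_algebra) (chart_inv_entry i j) => V; rewrite mxvecE.
Qed.

Lemma chart_inv_open (U : set MxK) : zopen U ->
  zopen (chart_domain `&` chart_inv @^-1` U).
Proof.
have [D D1 DE] := chart_det_plucker; move=> [I ->].
(* [Q'] is controlled only on the chart; the factor [D] makes the form vanish elsewhere. *)
exists [set Q | exists e, exists P Q', [/\ Q = D * Q', Q' \is e.-homog, I P &
  forall V, chart_domain V ->
    pleval Q' V = \det (chart_top (frame V)) ^+ e * mxeval P (chart_inv V)]].
split=> [_ [e [P [Q [-> Qe _ _]]]]|].
  by exists (1 + e)%N; apply: dhomogM.
apply/seteqP; split=> V /=.
  move=> [VD [P IP PV]]; have [e [Q Qe QP]] := chart_pullback P.
  exists (D * Q); first by exists e, P, Q.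
  by rewrite /pleval mevalM -!/(pleval _ V) DE QP // !mulf_neq0 // expf_neq0.
move=> [_ [e [P [Q [-> Qe IP QP]]]]].
rewrite /pleval mevalM -!/(pleval _ V) DE mulf_eq0 negb_or => /andP[VD].
by rewrite QP // mulf_eq0 negb_or => /andP[_ PV]; split=> //; exists P.
Qed.

Lemma chart_inv_regular (U : set MxK) (f : MxK -> K) : regular U f ->
  regular (chart_domain `&` chart_inv @^-1` U) (f \o chart_inv).
Proof.
have [D D1 DE] := chart_det_plucker.
have De e : D ^+ e \is e.-homog by have := dhomogMn e D1; rewrite mul1n.
have DeE e V : pleval (D ^+ e) V = \det (chart_top (frame V)) ^+ e.
  by rewrite /pleval rmorphXn /= -DE.
move=> Uf V [VD /Uf[P [Q [Qx fPQ]]]].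
have [e [P' Pe PE]] := chart_pullback P;
  have [e' [Q' Qe QE]] := chart_pullback Q.
have PQE W : chart_domain W ->
    (pleval (P' * D ^+ e') W = \det (chart_top (frame W)) ^+ (e + e') * mxeval
      P (chart_inv W))
  * (pleval (D ^+ e * Q') W =
    \det (chart_top (frame W)) ^+ (e + e') * mxeval Q (chart_inv W)).
  move=> WD; rewrite /pleval !mevalM -!/(pleval _ W) PE // QE // !DeE exprD.
  by split; rewrite ?mulrA // mulrAC.
(* The powers of [D] bring numerator and denominator to the same degree and cancel in the
   quotient. *)
exists (e + e')%N, (P' * D ^+ e'), (D ^+ e * Q'); split; try exact: dhomogM.
  by rewrite PQE // mulf_neq0 // expf_neq0.
move=> W [WD WU]; rewrite !PQE // mulf_eq0 negb_or => /andP[dW QW] /=.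
by rewrite fPQ // -mulf_div divff // mul1r.
Qed.

(** The whole affine space is isomorphic to the open chart, and subsets carry the induced structure,
    so only a pointwise comparison of [X] with [Y] remains. *)
Lemma open_immersion_phi (X : set MxK) (Y : set GrK) :
  (forall x, X x <-> Y (phi x)) -> open_immersion X Y phi.
Proof.
move=> XY; exists (Y `&` chart_domain).
  exists chart_domain => //; have [D D1 DE] := chart_det_plucker.
  exists [set D]; split; first by move=> _ ->; exists 1%N.
  by apply/seteqP; split=> V; rewrite /chart_domain /= -DE;
    [exists D | move=> [_ ->]].
split.
  split=> [x Xx|U [W oW ->]|U f [W oW ->] fU].
  - by split; [apply/XY | apply: chart_domain_phi].
  - exists (phi @^-1` W); first exact: phi_open.
    apply/seteqP; split=> x /=; first by case=> ? [].
    by move=> [Xx Wx]; do !split => //; [apply/XY | apply: chart_domain_phi].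
  - move=> x [Xx Ux]; have [W' [g [oW' W'x W'g fg]]] := fU _ Ux.
    exists (phi @^-1` W'), (g \o phi); split=> //.
    + exact: phi_open.
    + exact: phi_regular.
    + by move=> y [_ Uy] W'y; apply: fg.
exists chart_inv; split=> [|x _|V [_ VD]]; last 2 first.
- exact: chart_inv_phi.
- exact: phi_chart_inv.
split=> [V [YV VD]|U [W oW ->]|U f [W oW ->] fU].
- by apply/XY; rewrite phi_chart_inv.
- exists (chart_domain `&` chart_inv @^-1` W); first exact: chart_inv_open.
  apply/seteqP; split=> V /=; first by case=> -[? ?] [].
  move=> [[YV VD] [_ WV]]; do !split => //.
  by apply/XY; rewrite phi_chart_inv.
- move=> V [[YV VD] UV]; have [W' [g [oW' W'V W'g fg]]] := fU _ UV.
  exists (chart_domain `&` chart_inv @^-1` W'), (g \o chart_inv); split=> //.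
  + exact: chart_inv_open.
  + exact: chart_inv_regular.
  + by move=> Z [_ UZ] [_ W'Z]; apply: fg.
Qed.

End Chart.
End GraphChart.

(** * Schubert conditions, adapted bases and Borel orbits in a Grassmannian *)

Section SchubertConditions.
Local Open Scope classical_set_scope.

Lemma bigmin_spec (s : seq nat) (P : pred nat) (G : nat -> nat) x0 :
  let M := (\big[minn/x0]_(i <- s | P i) G i)%N in
  [/\ (M <= x0)%N, forall i, i \in s -> P i -> (M <= G i)%N &
    M = x0 \/ exists i, [/\ i \in s, P i & M = G i]].
Proof.
elim: s => [|j s] /=; first by rewrite big_nil; split=> //; left.
rewrite big_cons; case Pj: (P j) => -[le0 leG E]; last first.
  split=> // [i|]; first by rewrite inE => /predU1P[->|/leG//]; rewrite Pj.
  by case: E => [|[i [si Pi E]]]; [left | right; exists i; rewrite inE si orbT].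
split=> [|i|].
- by rewrite geq_min le0 orbT.
- rewrite inE geq_min => /predU1P[->|si Pi]; first by rewrite leqnn.
  by rewrite leG ?orbT.
- case: leqP => _; first by right; exists j; rewrite mem_head.
  by case: E => [|[i [si Pi E]]]; [left | right; exists i; rewrite inE si orbT].
Qed.

(** Greedy choice: [k] vectors span dimension at most [k], so they cannot fill [U k]. The spaces
    need not be nested. *)
Lemma free_in_subspaces (F : fieldType) (vT : vectType F) (U : nat -> {vspace
  vT})
    d : (forall k, (k < d)%N -> (k < \dim (U k))%N) ->
  exists s : seq vT,
    [/\ size s = d, free s & forall k, (k < d)%N -> s`_k \in U k].
Proof.
elim: d => [|d IH] dimU; first by exists [::]; rewrite nil_free.
have [k kd|s [sd fs sU]] := IH; first by rewrite dimU // ltnW.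
have /subvPn[v vU vs] : ~~ (U d <= <<s>>)%VS.
  apply: contraL (dimU d (ltnSn d)) => /dimvS Us; rewrite -leqNgt.
  by apply: leq_trans Us _; rewrite (eqP fs) sd.
exists (rcons s v); split=> [||k].
- by rewrite size_rcons sd.
- by rewrite -cats1 -(perm_free (permEl (perm_catC _ _))) cat1s free_cons vs.
- rewrite ltnS leq_eqVlt nth_rcons sd => /predU1P[->|kd];
  first by rewrite ltnn eqxx.
  by rewrite kd sU.
Qed.

Variables (K : closedFieldType) (d N : nat).
Implicit Types (V : Gr_point K d N) (A : 'M[K]_(N, d)).

Lemma memv_Estd t (v : 'cV[K]_N) :
  reflect (forall i : 'I_N, (t <= i)%N -> v i 0 = 0) (v \in Estd K N t).
Proof.
rewrite Estd_colspan; apply: (iffP (memv_colspan _ _)) => [[c ->] i ti|v0].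
  by rewrite mul_mask_mx /lt_pred ltnNge ti mul0r.
exists v; apply/matrixP => i j; rewrite ord1 mul_mask_mx /lt_pred.
by case: ltnP => [_|/v0->]; rewrite ?mul1r ?mulr0.
Qed.

Lemma dim_cap_Estd V t : (t <= N)%N ->
  (\dim (val V :&: Estd K N t) + \rank (mask K (@ge_pred N t) *m frame V))%N =
    d.
Proof.
move=> tN; have := dimv_sum_cap (val V) (Estd K N t).
rewrite -{1}(colspan_frame V) dim_add_Estd // dim_Estd // (eqP (valP V)) addnC.
by rewrite addnCA addnC => /addIn.
Qed.

Lemma dim_cap_Estd_le V s t : (s <= t <= N)%N ->
  (\dim (val V :&: Estd K N t) + s <= \dim (val V :&: Estd K N s) + t)%N.
Proof.
move=> /andP[st tN]; have sN := leq_trans st tN.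
have Est : (Estd K N s <= Estd K N t)%VS.
  by apply/subvP => v /memv_Estd v0; apply/memv_Estd => i ti;
    rewrite v0 // (leq_trans st).
rewrite -{1}(dim_Estd K sN) -dimv_sum_cap -capvA (capv_idPr Est) addnC
  leq_add2l.
by rewrite -{2}(dim_Estd K tN) dimvS // subv_add capvSr.
Qed.

(** Basis extension: [r] independent rows inside [S] are completed by [e] rows independent modulo
    them, the quotient being taken with [cokermx]. *)
Lemma minor_extension_sum r e (A : 'M[K]_(N, r + e)) (S : pred 'I_N) :
  \rank A = (r + e)%N -> \rank (mask K S *m A) = r ->
  exists2 g : 'I_(r + e) -> 'I_N, \det (rowsub g A) != 0 &
    (r <= #|[pred k | S (g k)]|)%N.
Proof.
move=> rA rS.
have [f [h fh]] : exists f : 'I_r -> 'I_N, exists h : 'I_r -> 'I_(r + e),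
    \det (mxsub f h (mask K S *m A)) != 0 by apply: mxrank_minor; rewrite rS.
have Sf k : S (f k).
  apply: contraNT fh => /negbTE Sk; rewrite (expand_det_row _ k) big1 // => j _.
  by rewrite mxE mul_mask_mx Sk !mul0r.
have rR : \rank (rowsub f A) = r.
  apply/eqP; rewrite eqn_leq rank_leq_row;
    apply: (@minor_mxrank _ _ _ _ _ id h).
  apply: contraNneq fh => <-; apply/eqP; congr (\det _); apply/matrixP => i j.
  by rewrite [LHS]mxE [RHS]mxE [RHS]mxE mul_mask_mx Sf mul1r.
have fullA : row_full A by rewrite /row_full rA.
set Y := A *m cokermx (rowsub f A).
have rY : \rank Y = e by rewrite eqmxMfull // mxrank_coker rR addKn.
have [f2 [h2 fh2]] : exists f2 : 'I_e -> 'I_N, exists h2 : 'I_e -> 'I_(r + e),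
    \det (mxsub f2 h2 Y) != 0 by apply: mxrank_minor; rewrite rY.
have fY : row_free (rowsub f2 A *m cokermx (rowsub f A)).
  rewrite mul_rowsub_mx /row_free eqn_leq rank_leq_row.
  apply: (@minor_mxrank _ _ _ _ _ id h2).
  by apply: contraNneq fh2 => <-; apply/eqP; congr (\det _);
    apply/matrixP => i j; rewrite !mxE.
have rR2 : \rank (rowsub f2 A) = e.
  apply/eqP; rewrite eqn_leq rank_leq_row; move/eqP: fY => {1}<-.
  exact: mxrankM_maxl.
exists (fun k => match split k with inl i => f i | inr i => f2 i end);
  last first.
  rewrite -[X in (X <= _)%N](card_ord r) -(card_codom (@lshift_inj r e))
    subset_leq_card //.
  apply/fintype.subsetP => _ /codomP[i ->]; rewrite inE /=.
  by case: splitP => [j /= /val_inj <-|j /= ij]; rewrite ?Sf //;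
    have := ltn_ord i; rewrite ij ltnNge leq_addr.
have -> : rowsub (fun k => match split k with inl i => f i | inr i =>
  f2 i end) A
    = col_mx (rowsub f A) (rowsub f2 A).
  by apply/matrixP => i j; rewrite !mxE; case: (split i) => k; rewrite mxE.
rewrite -unitfE -unitmxE -row_free_unit /row_free -addsmxE mxrank_disjoint_sum
  ?rR ?rR2 //.
apply/eqP/rowV0P => v; rewrite sub_capmx => /andP[vf /submxP[b vb]].
have b0 : b *m (rowsub f2 A *m cokermx (rowsub f A)) = 0.
  by rewrite mulmxA -vb; apply/eqP; rewrite -submxE.
have b_eq0 : b = 0 by apply: (row_free_inj fY); rewrite b0 mul0mx.
by rewrite vb b_eq0 mul0mx.
Qed.

Lemma minor_extension A (S : pred 'I_N) : \rank A = d ->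
  exists2 g : 'I_d -> 'I_N, \det (rowsub g A) != 0 &
    (\rank (mask K S *m A) <= #|[pred k | S (g k)]|)%N.
Proof.
move=> rA; have [r rE] : exists r, r = \rank (mask K S *m A) by eexists.
have [e de] : exists e, d = (r + e)%N.
  by exists (d - r)%N; rewrite subnKC // rE rank_leq_col.
rewrite -rE; move: A rA rE; rewrite de => A rA rE.
exact: minor_extension_sum.
Qed.

Lemma minor_mask_rank A (S : pred 'I_N) (g : 'I_d -> 'I_N) :
  \det (rowsub g A) != 0 -> (#|[pred k | S (g k)]| <= \rank (mask K S *m A))%N.
Proof.
rewrite -unitfE -unitmxE -row_free_unit => free.
rewrite -(rank_mask K) -(mxrankMfree _ free).
have -> : mask K [pred k | S (g k)] *m rowsub g A = rowsub g (mask K S *m A).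
  by apply/matrixP => i j; rewrite mul_mask_mx [in LHS]mxE [RHS]mxE mul_mask_mx.
by rewrite rowsubE mxrankM_maxr.
Qed.

(** Smaller minors are not functions of the Plücker coordinates, so the bound is rephrased as the
    nonvanishing of some maximal minor with at least [c] of its rows in [S]. *)
Lemma open_rank_frame (S : pred 'I_N) c :
  zopen [set V : Gr K d N | (c <= \rank (mask K S *m frame V))%N].
Proof.
exists [set P | P \is 1.-homog /\ exists2 g : 'I_d -> 'I_N,
  (c <= #|[pred k | S (g k)]|)%N & forall A,
    P.@[pluckers A] = \det (rowsub g A)].
split; first by move=> P [P1 _]; exists 1%N.
apply/seteqP; split=> V /=.
  move=> cV; have [g gV gc] := minor_extension S (rank_frame V).
  have [P P1 PE] := minor_plucker K g.
  exists P; first by split=> //; exists g => //; apply: leq_trans gc.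
  by rewrite [pleval _ _]PE.
move=> [P [_ [g cg PE]]]; rewrite [pleval _ _]PE => /minor_mask_rank gV.
exact: leq_trans cg (gV S).
Qed.

Variables (m : nat) (t a : nat -> nat).
Hypothesis dN : (d <= N)%N.
Hypothesis tN : forall i, (1 <= i < m)%N -> (t i <= N)%N.
Hypothesis at_le : forall i, (1 <= i < m)%N -> (a i <= t i)%N.
Hypothesis ad_le : forall i, (1 <= i < m)%N -> (a i <= d)%N.

(** By [dim_cap_Estd] this is dim (V ∩ E_(t i)) >= [a i]; in rank form its failure is visibly
    open. *)
Definition schubert_conditions V := forall i, (1 <= i < m)%N ->
  (a i + \rank (mask K (@ge_pred N (t i)) *m frame V) <= d)%N.

(* The largest jump sequence compatible with [dim (V :&: E_(t i)) >= a i]. *)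
Definition jump (k : nat) : nat :=
  (\big[minn/N - d + k.+1]_(i <- iota 1 m.-1 | (k < a i)%N) (t i - a i +
    k.+1))%N.

Lemma mem_iota1 i : (i \in iota 1 m.-1) = (1 <= i < m)%N.
Proof. by rewrite mem_iota; case: m => [|m'] /=; lia. Qed.

Lemma jump_spec k :
  [/\ (jump k <= N - d + k.+1)%N,
      forall i, (1 <= i < m)%N -> (k < a i)%N -> (jump k <= t i - a i + k.+1)%N
        &
      jump k = (N - d + k.+1)%N \/ exists i, [/\ (1 <= i < m)%N, (k < a i)%N &
        jump k = (t i - a i + k.+1)%N]].
Proof.
have [] := bigmin_spec (iota 1 m.-1) (fun i => k < a i)%N
  (fun i => t i - a i + k.+1)%N (N - d + k.+1)%N.
rewrite -/(jump k) => le0 lei E; split=> // [i im|]; first by apply: lei;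
  rewrite mem_iota1.
by case: E => [|[i [im ki E]]]; [left | right; exists i; rewrite -mem_iota1].
Qed.

Lemma jump_gt0 k : (0 < jump k)%N.
Proof. by have [_ _ [|[i [_ _]]] ->] := jump_spec k; rewrite addnS. Qed.

Lemma jump_le k : (k < d)%N -> (jump k <= N)%N.
Proof. by move=> kd; have [le0 _ _] := jump_spec k; apply: leq_trans le0 _;
  lia. Qed.

Lemma jump_mono k : (jump k < jump k.+1)%N.
Proof.
have [le0 lei _] := jump_spec k; have [_ _ E] := jump_spec k.+1.
case: E => [->|[i [im ki ->]]]; first by lia.
by have := lei i im (ltnW ki); lia.
Qed.

Lemma jump_lt k l : (k < l)%N -> (jump k < jump l)%N.
Proof.
elim: l => // l IH; rewrite ltnS leq_eqVlt => /predU1P[->|/IH kl].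
  exact: jump_mono.
exact: ltn_trans kl (jump_mono l).
Qed.

Definition jump_adapted A :=
  forall (k : 'I_d) (i : 'I_N), (jump k <= i)%N -> A i k = 0.

(** By the greedy choice it is enough that [V] meets E_(jump k) in dimension above [k]. When the
    minimum is reached at [i], E_(t i) gives at least [a i], and descending by [a i - k.+1] steps
    loses at most one dimension per step. Otherwise the same count starts from the whole space. *)
Lemma exists_jump_adapted V : schubert_conditions V ->
  exists2 A, val V = colspan A & jump_adapted A.
Proof.
move=> VX; pose U k := (val V :&: Estd K N (jump k))%VS.
have dimU k : (k < d)%N -> (k < \dim (U k))%N.
  move=> kd; have jN := jump_le kd;
    have [_ _ [jE|[i [im ki jE]]]] := jump_spec k.
    have := @dim_cap_Estd_le V (jump k) N; rewrite jN leqnn => /(_ isT).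
    have : \dim (val V :&: Estd K N N) = d.
      have := dim_cap_Estd V (leqnn N).
      rewrite (_ : mask K (@ge_pred N N) = 0) ?mul0mx ?mxrank0 ?addn0 //.
      by apply/matrixP => i j; rewrite mask_entry mxE /ge_pred leqNgt ltn_ord
        andbF.
    by rewrite -/(U k) => ->; rewrite {1}jE; lia.
  have st : (jump k <= t i <= N)%N by rewrite tN // andbT jE;
    have := at_le im; lia.
  have := dim_cap_Estd_le V st; have := VX i im; have := dim_cap_Estd V (tN im).
  by have := at_le im; rewrite -/(U k) {1}jE; lia.
have [s [sd fs sU]] := free_in_subspaces dimU.
pose A : 'M[K]_(N, d) := \matrix_(i, k) s`_k i 0.
have colA (k : 'I_d) : col k A = s`_k by apply/matrixP => i j;
  rewrite !mxE ord1.
exists A; last first.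
  move=> k i ki; have := sU k (ltn_ord k);
    rewrite memv_cap => /andP[_ /memv_Estd].
  by move/(_ i ki); rewrite -colA mxE.
have -> : colspan A = <<s>>%VS.
  congr (<<_>>)%VS; apply: (@eq_from_nth _ 0);
    rewrite size_map size_enum_ord // => k kd.
  by rewrite (nth_map (Ordinal kd)) ?size_enum_ord // (nth_ord_enum _ (Ordinal
    kd)) colA.
apply/esym/eqP; rewrite eqEdim (eqP fs) sd (eqP (valP V)) leqnn andbT.
apply/span_subvP => v /(nthP 0)[k ks <-]; rewrite sd in ks.
by have := sU k ks; rewrite memv_cap => /andP[].
Qed.

(** The first [a i] columns of [A] are independent and lie in E_(t i), since [jump k <= t i] for
    [k < a i]. *)
Lemma jump_adapted_conditions V A :
  val V = colspan A -> jump_adapted A -> schubert_conditions V.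
Proof.
move=> VA jA i im; have := dim_cap_Estd V (tN im).
set rk := \rank _ => <-; rewrite leq_add2r.
have ad := ad_le im; pose B := colsub (widen_ord ad) A.
have rA : \rank A = d by rewrite -dim_colspan -VA (eqP (valP V)).
have /row_fullP[L LA] : row_full A by rewrite /row_full rA.
have fB : row_full B.
  apply/row_fullP; exists (rowsub (widen_ord ad) L).
  rewrite mul_rowsub_mx -[B]mulmx1 /B.
  have -> : L *m (colsub (widen_ord ad) A *m 1%:M) = colsub (widen_ord ad) 1%:M.
    by rewrite mulmx1 -LA -mulmx_colsub.
  by apply/matrixP => k l; rewrite !mxE -!val_eqE.
rewrite -[X in (X <= _)%N](dim_colspan_full fB) dimvS // subv_cap; apply/andP;
  split.
  by rewrite VA /B -[A in colsub _ A]mulmx1 -mulmx_colsub colspan_mul.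
apply/subvP => v /memv_colspan[c ->]; apply/memv_Estd => j tj.
rewrite mxE big1 // => k _; rewrite mxE jA ?mul0r //=.
have [_ lei _] := jump_spec k; apply: leq_trans (lei i im (ltn_ord k)) _.
apply: leq_trans tj; have := ltn_ord k; have := at_le im.
by move: (nat_of_ord k) => *; lia.
Qed.

Lemma jump_pred_lt (k : 'I_d) : ((jump k).-1 < N)%N.
Proof. by rewrite prednK ?jump_gt0 // jump_le. Qed.

Definition jump_ord (k : 'I_d) : 'I_N := Ordinal (jump_pred_lt k).

Lemma jump_ord_inj : injective jump_ord.
Proof.
move=> k l /(congr1 val) /= E; apply: val_inj; apply/eqP; move: E.
have := jump_gt0 k; have := jump_gt0 l.
by case: (ltngtP k l) => // /jump_lt; lia.
Qed.

(** Column [k] is the last basis vector of E_(jump k); the span is the coordinate point whose Borel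
    orbit turns out to be dense in the conditions. *)
Definition jump_mx : 'M[K]_(N, d) := \matrix_(i, k) (i == jump_ord k)%:R.

Lemma jump_mxK : jump_mx^T *m jump_mx = 1%:M.
Proof.
apply/matrixP => k l; rewrite mxE (bigD1 (jump_ord k)) //= !mxE eqxx mul1r.
rewrite (inj_eq jump_ord_inj) big1 ?addr0 // => i /negbTE ik.
by rewrite !mxE ik mul0r.
Qed.

Lemma rank_jump_mx : \rank jump_mx = d.
Proof.
apply/eqP; rewrite -[_ == _]/(row_full jump_mx); apply/row_fullP.
by exists jump_mx^T; apply: jump_mxK.
Qed.

Lemma mul_jump_mx (b : 'M[K]_N) i k : (b *m jump_mx) i k = b i (jump_ord k).
Proof.
rewrite mxE (bigD1 (jump_ord k)) //= mxE eqxx mulr1 big1 ?addr0 // =>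
  l /negbTE lk.
by rewrite mxE lk mulr0.
Qed.

(* The upper triangular matrix sending the coordinate subspace spanned by
   [jump_mx] to the column space of [A + s *: jump_mx]. *)
Definition jump_curve A (s : K) : 'M[K]_N :=
  1%:M + (A + (s - 1) *: jump_mx) *m jump_mx^T.

Lemma jump_curveE A s : jump_curve A s *m jump_mx = A + s *: jump_mx.
Proof.
rewrite mulmxDl mul1mx -mulmxA jump_mxK mulmx1 addrCA; congr (_ + _).
by rewrite -[X in X + _]scale1r -scalerDl addrC subrK.
Qed.

Lemma jump_curve_upper A s : jump_adapted A -> is_trig_mx (jump_curve A s)^T.
Proof.
move=> jA; apply/upperP => i j ji;
  rewrite mxE [1%:M _ _]mxE -val_eqE /= gtn_eqF // add0r.
rewrite mxE big1 // => k _; rewrite [jump_mx^T _ _]mxE [jump_mx _ _]mxE.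
case: eqP => [jk|]; rewrite ?mulr0 // mulr1.
rewrite !mxE jA ?add0r.
  by case: eqP => [ik|]; rewrite ?mulr0 //; move: ji; rewrite jk -ik ltnn.
by move: ji; rewrite jk /= -ltnS prednK ?jump_gt0.
Qed.

Lemma poly_fun_affine c c' : poly_fun (fun s : K => c + s * c').
Proof.
apply: (fa_add (poly_fun_algebra K));
  first exact: (fa_cst (poly_fun_algebra K)).
apply: (fa_mul (poly_fun_algebra K)); first exact: poly_fun_id.
exact: (fa_cst (poly_fun_algebra K)).
Qed.

Lemma generic_jump_curve A : jump_adapted A ->
  generic (fun s => jump_curve A s \in unitmx).
Proof.
move=> jA; pose f (k : 'I_d) s := jump_curve A s (jump_ord k) (jump_ord k).
have fE k s : f k s = A (jump_ord k) k + s * 1.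
  by rewrite /f -mul_jump_mx jump_curveE !mxE eqxx.
apply: generic_imp (generic_all (r := enum 'I_d) (A := fun k s =>
  f k s != 0) _).
  move=> s fs; rewrite (upper_diag_neq0 (jump_curve_upper _ jA));
    apply/forallP => i.
  case: (pickP (fun k => i == jump_ord k)) => [k /eqP->|ik];
    first by rewrite fs ?mem_enum.
  rewrite mxE [X in _ + X]mxE big1 ?addr0; first by rewrite mxE eqxx oner_neq0.
  by move=> k _; rewrite [jump_mx^T _ _]mxE [jump_mx _ _]mxE ik mulr0.
(* The diagonal entry is affine in [s] with slope 1, and this parameter gives it the value 1. *)
move=> k _; apply: (@generic_neq0 _ _ (1 - A (jump_ord k) k)).
  by apply: (fa_ext (poly_fun_algebra K)) (poly_fun_affine (A (jump_ord k) k)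
    1) => s; rewrite fE.
by rewrite fE mulr1 addrCA subrr addr0 oner_neq0.
Qed.

Lemma schubert_conditions_schubert :
  is_schubert_variety (schubert_conditions : set (Gr K d N)).
Proof.
have [V0 V0E] := Gr_point_of rank_jump_mx; exists V0.
apply/seteqP; split=> V.
  move=> /exists_jump_adapted[A VA jA] U [I [Ihom ->]] /= [P IP PV].
  have [e Pe] := Ihom P IP.
  have gP : generic (fun s => P.@[pluckers (A + s *: jump_mx)] != 0).
    apply: (@generic_neq0 _ _ 0).
      apply: fa_meval => [|k]; first exact: poly_fun_algebra.
      apply: fa_det => [|i j]; first exact: poly_fun_algebra.
      apply: (fa_ext (poly_fun_algebra K)) (poly_fun_affine (A (val (enum_val
        k) i) j)
        (jump_mx (val (enum_val k) i) j)) => s.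
      by rewrite [RHS]mxE [RHS]mxE [X in _ = _ + X]mxE.
    have [c c0 cE] := pleval_colspan VA.
    by move: PV; rewrite (cE e) // mulf_eq0 negb_or scale0r addr0 => /andP[].
  have [s [Ps sU]] := generic_ex (generic_and gP (generic_jump_curve jA)).
  have sV0 := gl_act_colspan sU V0E; exists (gl_act sU V0); split.
    by exists (jump_curve A s), sU; split=> //;
      rewrite /borel sU jump_curve_upper.
  exists P => //; rewrite jump_curveE in sV0;
    have [c c0 cE] := pleval_colspan sV0.
  by rewrite (cE e) // mulf_neq0 // expf_neq0.
(* Failure of a condition is open, so it would already occur on the orbit, whose points have adapted
   bases. *)
move=> clV i im; rewrite leqNgt; apply/negP => Vi.
have := clV _ (open_rank_frame (@ge_pred N (t i)) (d - a i).+1).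
case=> [|_ [[b [bU [bB ->]]]] /=]; first by rewrite /=; have := ad_le im; lia.
have bV0 := gl_act_colspan bU V0E.
have : schubert_conditions (gl_act bU V0 : Gr_point K d N).
  apply: jump_adapted_conditions bV0 _ => k j kj; rewrite mul_jump_mx.
  move: bB => /andP[_ /upperP]; apply => /=.
  by apply: leq_trans kj; rewrite prednK ?jump_gt0.
by move=> /(_ i im); have := ad_le im; lia.
Qed.

End SchubertConditions.

(** * Rational functions of one parameter *)

Section RationalCurves.
Variables (K : closedFieldType) (D : K -> K).
Hypothesis DP : poly_fun D.

(* Rational functions with denominator a power of [D]; their values at the zeros
   of [D] are junk. *)
Definition rat_fun (f : K -> K) := exists e,
  exists2 g : K -> K, poly_fun g & forall s, D s != 0 -> g s = D s ^+ e * f s.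

Lemma rat_fun_algebra : function_algebra rat_fun.
Proof.
have De e : poly_fun (fun s => D s ^+ e) by apply: fa_exp => //;
  exact: poly_fun_algebra.
split=> [f g fg [e [h hP hE]]|c|f g [e [h hP hE]] [e' [k kP kE]]|
    f g [e [h hP hE]] [e' [k kP kE]]].
- by exists e, h => // s Ds; rewrite hE // fg.
- exists 0%N, (fun=> c) => [|s _]; last by rewrite mul1r.
  exact: (fa_cst (poly_fun_algebra K)).
- exists (e + e')%N, (fun s => h s * D s ^+ e' + D s ^+ e * k s).
    by apply: (fa_add (poly_fun_algebra K));
      apply: (fa_mul (poly_fun_algebra K)).
  by move=> s Ds; rewrite hE // kE // exprD mulrDr mulrAC mulrA.
- exists (e + e')%N, (fun s => h s * k s);
  first exact: (fa_mul (poly_fun_algebra K)).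
  by move=> s Ds; rewrite hE // kE // exprD mulrACA.
Qed.

Lemma generic_rat_neq0 f s0 : rat_fun f -> D s0 != 0 -> f s0 != 0 ->
  generic (fun s => f s != 0).
Proof.
move=> [e [g gP gE]] D0 f0.
have gg : generic (fun s => g s != 0).
  by apply: (generic_neq0 gP (s0 := s0)); rewrite gE // mulf_neq0 // expf_neq0.
apply: generic_imp (generic_and gg (generic_neq0 DP D0)) => s [gs Ds].
by move: gs; rewrite gE // mulf_eq0 negb_or => /andP[].
Qed.

End RationalCurves.

(** * Comparison of the matrix Schubert variety with the Schubert conditions *)

Section CovexillaryChart.
Local Open Scope classical_set_scope.

Lemma monotone_extension (f : nat -> nat) m n :
  (forall i j, (1 <= i <= j)%N -> (j < m)%N -> (f i <= f j)%N) ->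
  f 0%N = 0%N -> f m = n -> (forall i, (1 <= i < m)%N -> (f i <= n)%N) ->
  forall i j, (i <= j <= m)%N -> (f i <= f j)%N.
Proof.
move=> mono f0 fm fn [|i] j; first by rewrite f0.
move=> /andP[ij]; rewrite leq_eqVlt => /predU1P[jm|jm]; last by rewrite mono.
move: ij; rewrite jm leq_eqVlt => /predU1P[->//|im].
by rewrite fm fn.
Qed.

Lemma block_index (f : nat -> nat) m k : f 0%N = 0%N -> (k < f m)%N ->
  exists j, [/\ (1 <= j <= m)%N & (f j.-1 <= k < f j)%N].
Proof.
move=> f0 km; have ex : exists j, (k < f j)%N by exists m.
exists (ex_minn ex); case: ex_minnP => j kj jmin.
have j0 : (0 < j)%N by case: j kj {jmin} => //; rewrite f0.
split; first by rewrite j0 jmin.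
by rewrite kj andbT leqNgt; apply/negP => /jmin; rewrite leqNgt ltn_predL j0.
Qed.

(** This describes the preimage of E_(p i + q i) under [tau] by the complementary indices. Block [j]
    of either half lands before the threshold if [j <= i] and after it otherwise. It is here that
    the simultaneous monotonicity of [p] and [q] enters. *)
Lemma interleaving_threshold n m p q (tau : 'S_(n + n)) :
  (forall i j, (i <= j <= m)%N -> (p i <= p j)%N) ->
  (forall i j, (i <= j <= m)%N -> (q i <= q j)%N) ->
  p 0%N = 0%N -> q 0%N = 0%N -> p m = n -> q m = n -> interleaving m p q tau ->
  forall i (k : 'I_n), (i <= m)%N ->
    ((p i + q i <= tau (lshift n k)) = (q i <= k))%N *
    ((p i + q i <= tau (rshift n k)) = (p i <= k))%N.
Proof.
move=> pm qm p0 q0 pn qn il i k im; split.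
  have [|j [jm jk]] := @block_index q m k q0; first by rewrite qn.
  have [tauE _] := il j jm; rewrite (tauE k jk);
    case/andP: jm jk => j0 jm /andP[jk kj].
  have [ij|ji] := ltnP i j.
    have lej : (i <= j.-1 <= m)%N by lia.
    by have := pm _ _ lej; have := qm _ _ lej; lia.
  have lej : (j <= i <= m)%N by lia.
  have lej' : (j.-1 <= i <= m)%N by lia.
  by have := pm _ _ lej'; have := qm _ _ lej; lia.
have [|j [jm jk]] := @block_index p m k p0; first by rewrite pn.
have [_ tauE] := il j jm; rewrite (tauE k jk);
  case/andP: jm jk => j0 jm /andP[jk kj].
have [ij|ji] := ltnP i j.
  have lej : (i <= j.-1 <= m)%N by lia.
  have lej' : (i <= j <= m)%N by lia.
  by have := pm _ _ lej; have := qm _ _ lej'; lia.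
have lej : (j <= i <= m)%N by lia.
by have := pm _ _ lej; have := qm _ _ lej; lia.
Qed.

Variables (K : closedFieldType) (n : nat) (w : 'S_n) (m : nat).
Variables (p q : nat -> nat) (tau : 'S_(n + n)).
Hypothesis ess : essential_listing w m p q.

Notation r i := (sw_rank (permmx K w) (p i) (q i)).
Notation Grv := (schubert_conditions m (fun i => p i + q i)%N (fun i =>
  q i - r i)%N
  : set (Gr K n (n + n))).
Notation phi := (tau_graph_map tau : mx_space K n n -> Gr K n (n + n)).

Definition essential_conditions (x : 'M[K]_n) :=
  forall i, (1 <= i < m)%N -> (sw_rank x (p i) (q i) <= r i)%N.

Lemma essential_rank_le i : (1 <= i < m)%N -> (r i <= q i)%N.
Proof.
move=> im; have /andP[_ qi] := essential_listing_bound ess im.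
by apply: leq_trans (mxrankM_maxr _ _) _; rewrite rank_mask card_lt_pred.
Qed.

Lemma Gr_v_schubert_conditions : Gr_v m p q (fun i => r i) = Grv.
Proof.
apply/seteqP; split=> V VX i im; have := VX i im;
  have /andP[pi qi] := essential_listing_bound ess im;
    have := essential_rank_le im;
  rewrite /= -{1}(colspan_frame V) dim_add_Estd; lia.
Qed.

Lemma Gr_v_schubert : is_schubert_variety (Grv : set (Gr K n (n + n))).
Proof.
apply: schubert_conditions_schubert => [|i im|i im|i im]; rewrite ?leq_addr //;
  have := essential_listing_bound ess im; lia.
Qed.

(** A rank above the bound would give a nonzero minor, hence an open neighbourhood meeting the orbit
    of [w], where ranks cannot exceed those of [w]. *)
Lemma matrix_schubert_essential_conditions (x : mx_space K n n) :
  matrix_schubert w x -> essential_conditions x.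
Proof.
move=> clx i im; rewrite leqNgt; apply/negP => xi.
have [f [g fg]] := mxrank_minor xi.
have openU := mx_open_neq0 (f := fun y : 'M[K]_n => \det (mxsub f g
  (mask K (@ge_pred n (p i)) *m y *m mask K (@lt_pred n (q i))))).
have [|y [[b1 [b2 [b1B b2B ->]]] /= yfg]] := clx _ (openU _) fg.
  apply: fa_det => [|k l]; first exact: mx_fun_algebra.
  have CA := mx_fun_algebra K n n.
  apply: (fa_ext CA) (fa_mul CA (fa_mul CA (fa_cst CA (f k \in @ge_pred n (p
    i))%:R)
    (mx_fun_entry K (f k) (g l))) (fa_cst CA (g l \in @lt_pred n (q i))%:R)) =>
      z.
  by rewrite mxE mul_mx_mask mul_mask_mx.
have := leq_trans (minor_mxrank yfg) (sw_rank_bruhat_cell w (p i) (q i) b1B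
  b2B).
by rewrite ltnn.
Qed.

Hypotheses (p0 : p 0%N = 0%N) (q0 : q 0%N = 0%N) (pn : p m = n) (qn : q m = n).
Hypothesis tauP : interleaving m p q tau.

(** Beyond the threshold the graph has the identity rows from [q i] on and the rows of [x] from
    [p i] on. The former contribute [n - q i] and clear the columns of [x] from [q i] on, which
    leaves exactly the southwest block. *)
Lemma schubert_conditions_graph (x : mx_space K n n) :
  Grv (phi x) <-> essential_conditions x.
Proof.
have tauE i (k : 'I_n) : (1 <= i < m)%N ->
    ((p i + q i <= tau (lshift n k)) = (q i <= k))%N *
    ((p i + q i <= tau (rshift n k)) = (p i <= k))%N.
  move=> /andP[_ /ltnW im]; case: (ess) => _ mp mq.
  apply: (interleaving_threshold _ _ p0 q0 pn qn tauP k im).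
    by apply: monotone_extension mp p0 pn _ =>
      j /(essential_listing_bound ess)/andP[/ltnW].
  by apply: monotone_extension mq q0 qn _ =>
    j /(essential_listing_bound ess)/andP[].
have rankE i : (1 <= i < m)%N ->
    \rank (mask K (@ge_pred (n + n) (p i + q i)) *m frame (phi x))
    = (n - q i + sw_rank x (p i) (q i))%N.
  move=> im; have /andP[_ qi] := essential_listing_bound ess im.
  have [C CU ->] := frame_eq (val_phi tau x).
  rewrite mulmxA mxrankMfree ?row_free_unit // /graph_mx mulmxA.
  have -> : mask K (@ge_pred (n + n) (p i + q i)) *m permmx K tau
      = permmx K tau *m mask K (fun k => p i + q i <= tau k)%N.
    apply/matrixP => k l; rewrite mul_mx_mask mul_mask_mx !mxE /ge_pred.
    by case: eqP => [->|]; rewrite ?mulr1 ?mul1r ?mulr0 ?mul0r.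
  rewrite -mulmxA eqmxMfull ?row_full_unit ?permmx_unit //.
  have -> : mask K (fun k => p i + q i <= tau k)%N *m col_mx 1%:M x
      = col_mx (mask K (@ge_pred n (q i))) (mask K (@ge_pred n (p i)) *m x).
    apply/matrixP => k l; rewrite mul_mask_mx; case: (split_ordP k) => k' ->.
      by rewrite !col_mxEu tauE // mxE mask_entry /ge_pred; case: eqP;
        rewrite ?mulr1 ?mulr0.
    by rewrite !col_mxEd tauE // mul_mask_mx.
  rewrite rank_col_mx_idem ?mask_idem // mask_predC; congr (_ + _)%N.
    have := cardC (@lt_pred n (q i));
      rewrite card_lt_pred // card_ord rank_mask.
    have -> : #|predC (@lt_pred n (q i))| = #|@ge_pred n (q i)|; last by lia.
    by apply: eq_card => k; exact: (esym (leqNgt (q i) k)).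
  rewrite /sw_rank (@eq_mask _ _ (predC _) (@lt_pred n (q i))) // => k.
  by rewrite /= /ge_pred -ltnNge.
split=> H i im; have := H i im; have := essential_rank_le im;
  have /andP[_ qi] := essential_listing_bound ess im; rewrite rankE //; lia.
Qed.

Lemma essential_conditions_matrix_schubert (x : mx_space K n n) :
  essential_conditions x -> matrix_schubert w x.
Proof.
have adapted (z : mx_space K n n) : essential_conditions z -> exists2 A :
  'M[K]_(n + n, n),
    val (phi z : Gr_point K n (n + n)) = colspan A &
    jump_adapted m (fun i => p i + q i)%N (fun i => q i - r i)%N A.
  move=> /schubert_conditions_graph; apply: exists_jump_adapted => [|i im|i im];
    rewrite ?leq_addr //; have := essential_listing_bound ess im; lia.
move=> xE U [I ->] [P IP Px].
have [A1 A1E jA1] := adapted x xE.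
have [A2 A2E jA2] := adapted (permmx K w) (fun i _ => leqnn _).
pose A s := A1 + s *: (A2 - A1).
have A_0 : A 0 = A1 by rewrite /A scale0r addr0.
have A_1 : A 1 = A2 by rewrite /A scale1r addrC subrK.
pose T s := chart_top tau (A s); pose D s := \det (T s).
(* The chart coordinate of the span of [A s]: a curve with [y 0 = x] and [y 1 = permmx K w],
   meaningful where [D s] is nonzero. *)
pose y s := chart_bot tau (A s) *m invmx (T s).
have entryA i j : poly_fun (fun s => A s i j).
  apply: (fa_ext (poly_fun_algebra K)) (poly_fun_affine (A1 i j) (A2 i j - A1 i
    j)) => s.
  by rewrite !mxE.
have entryT i j : poly_fun (fun s => T s i j).
  by apply: (fa_ext (poly_fun_algebra K)) (entryA (tau (lshift n i)) j) => s;
    rewrite [RHS]mxE.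
have DP : poly_fun D by apply: fa_det => //; exact: poly_fun_algebra.
have CA := rat_fun_algebra DP.
have entryy i j : rat_fun D (fun s => y s i j).
  exists 1%N, (fun s => (chart_bot tau (A s) *m \adj (T s)) i j).
    apply: fa_mulmx => [|a b|a b]; first exact: poly_fun_algebra.
      by apply: (fa_ext (poly_fun_algebra K)) (entryA (tau (rshift n a)) b) =>
        s; rewrite [RHS]mxE.
    by apply: fa_adj => //; exact: poly_fun_algebra.
  move=> s Ds; have TU : T s \in unitmx by rewrite unitmxE unitfE.
  by rewrite /y /invmx TU -scalemxAr [RHS]mulrC !mxE mulrC mulrA divff // mul1r.
have unit_phi (z : mx_space K n n) B : val (phi z : Gr_point K n (n + n)) =
  colspan B ->
    chart_top tau B \in unitmx /\ z =
      chart_bot tau B *m invmx (chart_top tau B).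
  move=> zB; have BU := (chart_domain_colspan tau zB).1 (chart_domain_phi tau
    z).
  by split=> //; rewrite -(chart_inv_colspan zB BU) chart_inv_phi.
have [T0 y0] := unit_phi _ _ A1E; have [T1 y1] := unit_phi _ _ A2E.
have D0 : D 0 != 0 by rewrite /D /T A_0 -unitfE -unitmxE.
have D1 : D 1 != 0 by rewrite /D /T A_1 -unitfE -unitmxE.
(* Being adapted is linear in the basis, so the upper bounds hold at every parameter of the
   chart. *)
have yZ s : D s != 0 -> essential_conditions (y s).
  move=> Ds; have TU : T s \in unitmx by rewrite unitmxE unitfE.
  have rA : \rank (A s) = n.
    apply/eqP; rewrite eqn_leq rank_leq_col /=.
    by have := mxrank_unit TU; rewrite /T /chart_top rowsubE => {1}<-;
      apply: mxrankM_maxr.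
  have [V VE] := Gr_point_of rA.
  have VD := (chart_domain_colspan tau VE).2 TU.
  rewrite /y -(chart_inv_colspan VE TU).
  apply/schubert_conditions_graph; rewrite phi_chart_inv //.
  apply: jump_adapted_conditions VE _ => [|i im|i im|i im|k i ki];
    rewrite ?leq_addr //; try by have := essential_listing_bound ess im; lia.
  by rewrite !mxE jA1 // jA2 // subr0 mulr0 addr0.
have gP : generic (fun s => mxeval P (y s) != 0).
  apply: (generic_rat_neq0 DP (s0 := 0)) => //; last by rewrite /y /T A_0 -y0.
  by apply: fa_meval => // k; case/mxvec_indexP: k => i j;
    apply: (fa_ext CA) (entryy i j) => s; rewrite mxvecE.
(* The lower bounds hold at [s = 1], where the curve passes through [w], and are therefore
   generic. *)
have grank i j : generic (fun s =>
  (sw_rank (permmx K w) i j <= sw_rank (y s) i j)%N).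
  have [f [g fg]] := mxrank_minor (leqnn (sw_rank (permmx K w) i j)).
  apply: generic_imp (generic_rat_neq0 DP (s0 := 1)
    (f := fun s => \det (mxsub f g (mask K (@ge_pred n i) *m y s *m mask K
      (@lt_pred n j))))
    _ D1 _) => [s|/=|]; first exact: minor_mxrank.
    apply: fa_det => // k l.
    apply: (fa_ext CA) (fa_mul CA (fa_mul CA (fa_cst CA (f k \in @ge_pred n
      i)%:R)
      (entryy (f k) (g l))) (fa_cst CA (g l \in @lt_pred n j)%:R)) => s.
    by rewrite [RHS]mxE mul_mx_mask mul_mask_mx.
  by rewrite /y /T A_1 -y1.
(* Only finitely many blocks, those with [i] and [j] at most [n], are involved, so one parameter
   serves them all. *)
have [s [[Ps Ds] rs]] := generic_ex (generic_and (generic_and gP (generic_neq0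
  DP D0))
  (generic_all (r := iota 0 n.+1) (fun i _ => generic_all (r := iota 0 n.+1)
    (fun j _ => grank i j)))).
exists (y s); split; last by exists P.
apply: mem_bruhat_cell => i j im jm; apply/eqP; rewrite eqn_leq.
rewrite (sw_rank_essential_listing ess (yZ s Ds)) /=.
by apply: rs; rewrite mem_iota /= add0n ltnS.
Qed.

End CovexillaryChart.

End CovexillarySchubert.

Theorem theorem1p6 (R : realType) (n : nat) (w : 'S_n)
    (m : nat) (p q : nat -> nat) (tau : 'S_(n + n)) :
  covexillary w ->
  (0 < m)%N ->
  essential_listing w m p q ->
  p 0%N = 0%N -> q 0%N = 0%N -> p m = n -> q m = n ->
  interleaving m p q tau ->
  let r := fun i : nat => rank_sw R[i] w (p i).+1 (q i) in
  let Grv : set (Gr R[i] n (n + n)) := Gr_v m p q r in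
  is_schubert_variety Grv /\
  open_immersion (matrix_schubert w : set (mx_space R[i] n n)) Grv
    (tau_graph_map tau).
Proof.
move=> _ _ ess p0 q0 pn qn tauP r Grv.
have GrvE : Grv = schubert_conditions m (fun i => p i + q i)%N
    (fun i => q i - sw_rank (permmx R[i] w) (p i) (q i))%N :> set (Gr R[i] n (n + n)).
  rewrite -(Gr_v_schubert_conditions _ ess) /Grv.
  have -> : r = fun i => sw_rank (permmx R[i] w) (p i) (q i); last by [].
  by apply: boolp.funext => i; apply: rank_sw_sw_rank.
rewrite GrvE; split; first exact: Gr_v_schubert ess.
apply: open_immersion_phi => x; split.
  move=> /(@matrix_schubert_essential_conditions _ _ _ m p q).
  by move=> /(schubert_conditions_graph ess p0 q0 pn qn tauP).
move=> /(schubert_conditions_graph ess p0 q0 pn qn tauP).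
exact: essential_conditions_matrix_schubert ess p0 q0 pn qn tauP _.
Qed.
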